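(* Let $(M,J)$ be a para-complex manifold and let $TM$ be its tangent bundle, endowed with the para-complex structure $J^{c}$ given by the complete lift of $J$. Then $TM$ admits a para-complex torsion-free affine connection, i.e. there exists an affine connection $D$ on the manifold $TM$ with $D J^{c}=0$ and with vanishing torsion, $D_AB-D_BA-[A,B]=0$ for all vector fields $A,B$ on $TM$.
   Context: All manifolds, maps and tensor fields are of class $C^{\infty}$. An almost para-complex manifold $(M,J)$ is a (necessarily even-dimensional) manifold $M$ with a tensor field $J$ of type $(1,1)$ such that $J^{2}=I$ and such that the two eigenbundles $T^{\pm}M$ of $J$ for the eigenvalues $\pm 1$ have the same rank. It is a para-complex manifold (and $J$ is a para-complex structure) if moreover the $G$-structure defined by $J$ (with structural group $GL(n,\mathbf{R})\times GL(n,\mathbf{R})$, $\dim M=2n$) is integrable, i.e. around each point there are local coordinates in which $J$ has constant components. Complete lifts from $M$ to $TM$: for a function $f$ on $M$, $f^{c}$ is the function on $TM$ with $f^{c}(Z_p)=Z_p(f)$ for $Z_p\in T_pM$; for a vector field $Z$ on $M$, $Z^{c}$ is the unique vector field on $TM$ with $Z^{c}(f^{c})=(Zf)^{c}$ for all functions $f$ on $M$; the complete lift $J^{c}$ is the unique $(1,1)$ tensor field on $TM$ with $J^{c}(Z^{c})=(JZ)^{c}$ for all vector fields $Z$ on $M$. One has $(J^{c})^{2}=I$. An affine connection $D$ on $TM$ is called para-complex (with respect to $J^{c}$) if $D J^{c}=0$. *)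

(* Defs.v *)
From HB Require Import structures.
From mathcomp Require Import all_boot all_order all_algebra.
From mathcomp Require Import all_classical all_reals all_analysis.

Set Implicit Arguments.
Unset Strict Implicit.
Unset Printing Implicit Defensive.

Import Order.TTheory GRing.Theory Num.Theory.
Import numFieldNormedType.Exports.

Local Open Scope classical_set_scope.
Local Open Scope ring_scope.

(* C^k and C^oo maps on an open set [O] of R^m; a map is C^(k+1) on [O] when
   it is differentiable there and all its directional derivatives are C^k. *)
Fixpoint Ck (R : realType) (m : nat) (W : normedModType R) (k : nat)
    (O : set 'rV[R]_m) (f : 'rV[R]_m -> W) : Prop :=
  match k with
  | 0%N => forall x, O x -> {for x, continuous f}
  | k'.+1 => (forall x, O x -> differentiable f x) /\
             (forall v : 'rV[R]_m, Ck k' O (fun x => 'D_v f x))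
  end.

Definition smooth_on (R : realType) (m : nat) (W : normedModType R)
    (O : set 'rV[R]_m) (f : 'rV[R]_m -> W) : Prop :=
  forall k, Ck k O f.

Record chart (R : realType) (m : nat) (M : topologicalType) := Chart {
  cdom : set M;
  cmap : M -> 'rV[R]_m (* only relevant on [cdom] *)
}.

(* Only the data of an atlas; the axioms are in [smooth_manifold]. *)
Record atlas (R : realType) (m : nat) (M : topologicalType) := Atlas {
  ix : Type;
  chart_of :> ix -> chart R m M
}.

Section Charts.
Context {R : realType} {m : nat} {M : topologicalType}.
Implicit Types (c d : chart R m M) (A : atlas R m M).

Definition cimg c : set 'rV[R]_m := cmap c @` cdom c.

(* F \o (cmap c)^-1 on [cimg c], extended by 0 outside [cimg c]. *)
Definition local_rep c (W : normedModType R) (F : M -> W) : 'rV[R]_m -> W :=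
  fun x => xget 0 [set y | exists q, [/\ cdom c q, cmap c q = x & y = F q]].

(* [cmap c] is a homeomorphism from the open set [cdom c] onto an open subset
   of R^m: it is continuous, injective and open on [cdom c]. *)
Definition is_chart c : Prop :=
  [/\ open (cdom c),
      {within cdom c, continuous (cmap c)},
      {in cdom c &, injective (cmap c)} &
      forall V : set M, open V -> V `<=` cdom c -> open (cmap c @` V)].

(* Smoothness of cmap d \o (cmap c)^-1 where it is defined. *)
Definition smooth_transition c d : Prop :=
  smooth_on (cmap c @` (cdom c `&` cdom d)) (local_rep c (cmap d)).

Definition smooth_manifold A : Prop :=
  [/\ hausdorff_space M, second_countable (T := M),
      forall p : M, exists i : ix A, cdom (A i) p,
      forall i : ix A, is_chart (A i) &
      forall i j : ix A, smooth_transition (A i) (A j)].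

(* The local coordinates: the charts of the maximal atlas containing [A]. *)
Definition local_coordinates A c : Prop :=
  is_chart c /\
  forall i : ix A, smooth_transition c (A i) /\ smooth_transition (A i) c.

Definition smooth_in c (W : normedModType R) (F : M -> W) : Prop :=
  smooth_on (cimg c) (local_rep c F).

Definition smooth_fun A (f : M -> R) : Prop :=
  forall i : ix A, smooth_in (A i) (f : M -> R^o).

End Charts.

(* A tangent vector at [p] is a family of coordinate vectors, one for each
   chart around [p], related by the differentials of the coordinate changes;
   the components for the charts not containing [p] are set to 0. *)
Definition is_tangent (R : realType) (m : nat) (M : topologicalType)
    (A : atlas R m M) (p : M) (v : ix A -> 'rV[R]_m) : Prop :=
  (forall i, ~ cdom (A i) p -> v i = 0) /\
  (forall i j, cdom (A i) p -> cdom (A j) p ->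
    v j = 'd (local_rep (A i) (cmap (A j))) (cmap (A i) p) (v i)).

Definition tangent_pred (R : realType) (m : nat) (M : topologicalType)
    (A : atlas R m M) (p : M) : {pred (ix A -> 'rV[R]_m)} :=
  fun v => `[< is_tangent p v >].

Lemma tangent_pred_submod (R : realType) (m : nat) (M : topologicalType)
    (A : atlas R m M) (p : M) : submod_closed (tangent_pred (A := A) p).
Proof.
split=> [|a u v].
  by apply/asboolP; split=> // i j _ _; rewrite linear0.
move=> /asboolP[u0 uE] /asboolP[v0 vE]; apply/asboolP; split=> [i pi|i j pi pj].
  change (a *: u i + v i = 0).
  by rewrite u0 // v0 // scaler0 addr0.
change (a *: u j + v j = 'd (local_rep (A i) (cmap (A j))) (cmap (A i) p)
  (a *: u i + v i)).
by rewrite linearP -uE // -vE.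
Qed.

HB.instance Definition _ (R : realType) (m : nat) (M : topologicalType)
    (A : atlas R m M) (p : M) :=
  GRing.isSubmodClosed.Build R _ (tangent_pred (A := A) p)
    (tangent_pred_submod A p).

Record tangent (R : realType) (m : nat) (M : topologicalType)
    (A : atlas R m M) (p : M) := Tangent {
  coords :> ix A -> 'rV[R]_m;
  coordsP : coords \in tangent_pred p
}.

HB.instance Definition _ R m M A p :=
  [isSub for (@coords R m M A p)].
HB.instance Definition _ R m M A p :=
  [Choice of @tangent R m M A p by <:].
HB.instance Definition _ R m M A p :=
  [SubChoice_isSubLmodule of @tangent R m M A p by <:].

Section TangentBundle.
Context {R : realType} {m : nat} {M : topologicalType}.

Record tbundle (A : atlas R m M) := TVec {
  base : M;
  tvec : tangent A base
}.

Context (A : atlas R m M).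

HB.instance Definition _ := gen_eqMixin (tbundle A).
HB.instance Definition _ := gen_choiceMixin (tbundle A).

Definition tchart_dom (i : ix A) : set (tbundle A) :=
  [set z | cdom (A i) (base z)].

Definition tchart_map (i : ix A) (z : tbundle A) : 'rV[R]_(m + m) :=
  row_mx (cmap (A i) (base z)) (tvec z i).

(* The topology of the tangent bundle, generated by the chart domains and the
   inverse images of open sets under the charts. *)
Definition tbundle_subbase : set (set (tbundle A)) :=
  [set V | exists i (O : set 'rV[R]_(m + m)),
    open O /\ V = tchart_dom i `&` tchart_map i @^-1` O].

HB.instance Definition _ :=
  isSubBaseTopological.Build (tbundle A) tbundle_subbase id.

Definition tatlas : atlas R (m + m) (tbundle A) :=
  @Atlas R (m + m) (tbundle A) (ix A)
    (fun i => Chart (tchart_dom i) (tchart_map i)).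

End TangentBundle.

Section Fields.
Context {R : realType} {m : nat} {M : topologicalType} (A : atlas R m M).

(* The derivative v(F) of [F] along the tangent vector [v]: the common value
   of d(F \o (A i)^-1)(v i) over the charts [A i] around [p]. *)
Definition tderiv (p : M) (v : tangent A p) (W : normedModType R)
    (F : M -> W) : W :=
  xget 0 [set w | exists2 i, cdom (A i) p &
                    w = 'd (local_rep (A i) F) (cmap (A i) p) (v i)].

Definition vfield := forall p : M, tangent A p.

Definition smooth_vfield (X : vfield) : Prop :=
  forall i : ix A, smooth_in (A i) (fun p => X p i).

Definition vderiv (X : vfield) (f : M -> R) : M -> R :=
  fun p => tderiv (X p) (f : M -> R^o).

(* Tensor fields of type (1,1) *)
Definition endo_field := forall p : M, {linear tangent A p -> tangent A p}.

Definition smooth_endo_field (J : endo_field) : Prop :=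
  exists K : ix A -> M -> 'M[R]_m, forall i,
    smooth_in (A i) (K i) /\
    forall p (v : tangent A p), cdom (A i) p -> J p v i = v i *m K i p.

Definition endo_app (J : endo_field) (X : vfield) : vfield :=
  fun p => J p (X p).

Definition has_dim (V : lmodType R) (E : set V) (r : nat) : Prop :=
  exists b : 'I_r -> V, (forall k, E (b k)) /\
    forall v, E v -> exists! a : 'rV[R]_r, v = \sum_(k < r) a 0 k *: b k.

Definition almost_para_complex (J : endo_field) : Prop :=
  [/\ smooth_endo_field J,
      forall p (v : tangent A p), J p (J p v) = v &
      exists r : nat, forall p,
        has_dim [set v : tangent A p | J p v = v] r /\
        has_dim [set v : tangent A p | J p v = - v] r].

(* Around each point there are local coordinates [c] in which the matrix [K]
   of components of [J] is constant; [tderiv v (cmap c)] is the row of the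
   components of [v] in the coordinates [c]. *)
Definition integrable_endo (J : endo_field) : Prop :=
  forall p : M, exists (c : chart R m M) (K : 'M[R]_m),
    [/\ local_coordinates A c, cdom c p &
        forall q (v : tangent A q), cdom c q ->
          tderiv (J q v) (cmap c) = tderiv v (cmap c) *m K].

Definition para_complex (J : endo_field) : Prop :=
  almost_para_complex J /\ integrable_endo J.

Definition is_bracket (X Y B : vfield) : Prop :=
  smooth_vfield B /\
  forall f, smooth_fun A f -> forall p,
    vderiv B f p = vderiv X (vderiv Y f) p - vderiv Y (vderiv X f) p.

(* The values of [D] on non-smooth arguments are irrelevant. *)
Definition affine_connection (D : vfield -> vfield -> vfield) : Prop :=
  [/\ forall X Y, smooth_vfield X -> smooth_vfield Y -> smooth_vfield (D X Y),
      forall X X' Y,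
        smooth_vfield X -> smooth_vfield X' -> smooth_vfield Y ->
        forall p, D (fun q => X q + X' q) Y p = D X Y p + D X' Y p,
      forall f X Y, smooth_fun A f -> smooth_vfield X -> smooth_vfield Y ->
        forall p, D (fun q => f q *: X q) Y p = f p *: D X Y p,
      forall X Y Y',
        smooth_vfield X -> smooth_vfield Y -> smooth_vfield Y' ->
        forall p, D X (fun q => Y q + Y' q) p = D X Y p + D X Y' p &
      forall f X Y, smooth_fun A f -> smooth_vfield X -> smooth_vfield Y ->
        forall p, D X (fun q => f q *: Y q) p =
                  f p *: D X Y p + vderiv X f p *: Y p].

(* (D_X J) Y = D_X (J Y) - J (D_X Y) vanishes for all X and Y. *)
Definition para_complex_connection (J : endo_field)
    (D : vfield -> vfield -> vfield) : Prop :=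
  forall X Y, smooth_vfield X -> smooth_vfield Y ->
    forall p, D X (endo_app J Y) p - J p (D X Y p) = 0.

Definition torsion_free (D : vfield -> vfield -> vfield) : Prop :=
  forall X Y, smooth_vfield X -> smooth_vfield Y ->
    exists2 B, is_bracket X Y B & forall p, D X Y p - D Y X p - B p = 0.

End Fields.

Section CompleteLifts.
Context {R : realType} {m : nat} {M : topologicalType} (A : atlas R m M).

Definition lift_fun (f : M -> R) : tbundle A -> R :=
  fun z => tderiv (tvec z) (f : M -> R^o).

Definition lifts_vfield (Z : vfield A) (Zc : vfield (tatlas A)) : Prop :=
  smooth_vfield Zc /\
  forall f, smooth_fun A f ->
    forall z, vderiv Zc (lift_fun f) z = lift_fun (vderiv Z f) z.

(* [Zc] is the complete lift of [Z] *)
Definition complete_lift_vfield (Z : vfield A) (Zc : vfield (tatlas A)) : Prop :=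
  lifts_vfield Z Zc /\
  forall Zc', lifts_vfield Z Zc' -> forall z, Zc' z = Zc z.

(* For each smooth [Z], the complete lift of [Z] exists and [Jc] maps it to
   the complete lift of [J Z]. *)
Definition lifts_endo (J : endo_field A) (Jc : endo_field (tatlas A)) : Prop :=
  smooth_endo_field Jc /\
  forall Z, smooth_vfield Z -> exists2 Zc,
    complete_lift_vfield Z Zc &
    complete_lift_vfield (endo_app J Z) (endo_app Jc Zc).

(* [Jc] is the complete lift of [J] *)
Definition complete_lift_endo (J : endo_field A) (Jc : endo_field (tatlas A)) :
    Prop :=
  lifts_endo J Jc /\
  forall Jc', lifts_endo J Jc' -> forall z w, Jc' z w = Jc z w.

End CompleteLifts.

(* Main.v *)
(* In a chart [c] of [M] where [J] has a constant matrix [K], the complete lift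
   has, in the induced chart [(c, dc)] of the tangent bundle, the constant matrix
   [diag(K, K)]. The flat connection of that chart is therefore torsion-free and
   parallelizes the complete lift. Both properties are preserved by convex
   combinations, so these local connections are glued by a partition of unity on
   [M] pulled back to the bundle. The lift is unique because the complete lifts
   of vector fields span the tangent spaces of the bundle off the zero section,
   and on the zero section by continuity. *)
Require Import Defs.
From HB Require Import structures.
From mathcomp Require Import all_boot all_order all_algebra.
From mathcomp Require Import all_classical all_reals all_analysis.
From mathcomp Require Import ring.

Set Implicit Arguments.
Unset Strict Implicit.
Unset Printing Implicit Defensive.

Import Order.TTheory GRing.Theory Num.Theory.
Import numFieldNormedType.Exports.

Local Open Scope classical_set_scope.
Local Open Scope ring_scope.

(** The obstacle is that induced charts of the bundle change by the tangent map of a coordinate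
    change [t], whose differential contains the second derivative of [t]. That [block_diag K]
    describes the same tensor in all adapted charts amounts to differentiating the relation by which
    the differential of [t] intertwines the constant matrices of [J], and then exchanging two
    derivatives; hence the section on the symmetry of second derivatives. The same symmetry makes
    [D_X Y - D_Y X], for a flat connection [D], act on functions as a commutator. Bump functions are
    the only passage from local to global: with them connections are glued, and the test functions
    and test fields for complete lifts are extended. At a zero tangent vector lifted functions have
    no horizontal differential, so uniqueness has to pass through a limit there. Smoothness is
    always read in charts, as a statement on row vectors, so that one calculus serves both the base
    and the bundle. *)

(** * Differentiability: locality, product rule, linear maps *)

Lemma near_eq_differentiable (R : numFieldType) (V W : normedModType R)
    (f g : V -> W) (x : V) :
  (\near x, f x = g x) -> differentiable f x -> differentiable g x.
Proof.
move=> fg df.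
have fgx : f x = g x := nbhs_singleton fg.
(* The difference vanishes near [x], hence is differentiable there with differential 0, and [g] is
   the sum of [h] and [f]. *)
pose h := g - f.
have h0 : \forall k \near (0 : V), (h \o shift x) k = 0.
  rewrite (near_shift x) /=; near=> z; rewrite /= sub0r addrNK /h fctE.
  by rewrite -(near fg z) // -[(- f) z]/(- f z) subrr.
have hE : h \o shift x = cst (h x) + \0 +o_ (0 : V) id.
  apply/eqaddoP => e e0; apply: filterS h0 => k hk.
  rewrite [X in `|X|](_ : _ = 0) ?normr0 ?mulr_ge0 ?(ltW e0) //.
  rewrite -[LHS]/((h \o shift x) k - (h x + 0)) hk /h.
  by rewrite -[(g - f) x]/(g x - f x) fgx subrr addr0 subr0.
have dh : differentiable h x.
  apply/diff_locallyP.
  have -> : ('d h x : V -> W) = \0.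
    by rewrite (@diff_unique _ _ _ h \0) //; exact: cst_continuous.
  by split => //; exact: cst_continuous.
by rewrite -(subrK f g); apply: differentiableD.
Unshelve. all: by end_near. Qed.

Section ScaleBilinear.
Context {R : numFieldType} {W : normedModType R}.

Let bscale (a : R^o) (w : W) := a *: w.

Let bscale_is_bilinear : bilinear_for
    (GRing.Scale.Law.clone _ _ *:%R _) (GRing.Scale.Law.clone _ _ *:%R _)
    bscale.
Proof.
split=> [u'|u] a x y /=; first by rewrite /bscale scalerDl scalerA.
by rewrite /bscale scalerDr !scalerA mulrC.
Qed.

HB.instance Definition _ := bilinear_isBilinear.Build R R^o W W _ _
  bscale bscale_is_bilinear.

(** The product rule is the chain rule through the pairing of [f] and [g], once scaling is
    registered as a continuous bilinear map. *)
Lemma differentiable_scale (V : normedModType R) (f : V -> R^o) (g : V -> W) x :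
  differentiable f x -> differentiable g x ->
  differentiable (fun y => f y *: g y) x /\
  forall v, 'd (fun y => f y *: g y) x v = f x *: 'd g x v + 'd f x v *: g x.
Proof.
move=> df dg.
have sc : continuous (fun p : R^o * W => bscale p.1 p.2) by exact: scale_continuous.
have dB := differentiable_bilin (f x, g x) sc.
have dp := differentiable_pair df dg.
split; first exact: (differentiable_comp dp dB).
move=> v; rewrite (_ : (fun y => f y *: g y) =
  (fun p => bscale p.1 p.2) \o (fun y => (f y, g y))) //.
by rewrite diff_comp //= (diff_bilin _ sc) diff_pair.
Qed.

End ScaleBilinear.

Lemma near_comp (S T : topologicalType) (f : S -> T) (x : S) (P : T -> Prop) :
  {for x, continuous f} -> (\forall y \near f x, P y) ->
  \forall y \near x, P (f y).
Proof. by move=> cf; exact: cf. Qed.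

(** In finite dimension [L] is a finite sum of coordinate functions times fixed vectors. *)
Lemma mx_linear_continuous (R : realType) m n (W : normedModType R)
    (L : {linear 'M[R]_(m, n) -> W}) : continuous L.
Proof.
have -> : (L : 'M[R]_(m, n) -> W) =
    (fun M => \sum_i \sum_j M i j *: L (delta_mx i j)).
  apply/funext => M; rewrite {1}[M]matrix_sum_delta linear_sum.
  apply: eq_bigr => i _; rewrite linear_sum; apply: eq_bigr => j _.
  by rewrite linearZ.
apply: continuous_big => [|i _]; first exact: add_continuous.
apply: continuous_big => [|j _]; first exact: add_continuous.
by move=> M; apply: continuousZr_tmp; exact: coord_continuous.
Qed.

(** A named linear map with values in the normed module [R^o], so that the results on linear maps
    apply to matrix entries. *)
Definition mxentry (R : realType) m n i j (M : 'M[R]_(m, n)) : R^o := M i j.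

Lemma mxentry_is_linear (R : realType) m n i j : linear (@mxentry R m n i j).
Proof. by move=> a M N; rewrite /mxentry !mxE. Qed.

HB.instance Definition _ (R : realType) m n i j :=
  GRing.isLinear.Build R 'M[R]_(m, n) R^o _ (@mxentry R m n i j)
    (@mxentry_is_linear R m n i j).

(** * Smooth maps between real vector spaces *)

Section Ck.
Context {R : realType} {m : nat}.
Implicit Types (W : normedModType R) (O : set 'rV[R]_m) (x v : 'rV[R]_m).

Lemma Ck_sub W k O O' (f : 'rV[R]_m -> W) : O' `<=` O -> Ck k O f -> Ck k O' f.
Proof.
elim: k f => [|k IH] f sO /=; first by move=> h x /sO /h.
by move=> [df Df]; split=> [x /sO/df|v] //; exact: IH.
Qed.

(** Openness of [O] turns equality on [O] into equality near each of its points, which is what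
    derivatives depend on. *)
Lemma Ck_eq W k O (f g : 'rV[R]_m -> W) : open O -> (forall x, O x -> f x = g x) ->
  Ck k O f -> Ck k O g.
Proof.
move=> oO; have On x : O x -> \forall y \near x, O y.
  by move=> Ox; exact: open_nbhs_nbhs.
elim: k f g => [|k IH] f g fg /=.
  move=> cf x Ox; rewrite /continuous_at /prop_for -(fg x Ox).
  apply: cvg_trans (cf x Ox); apply: (@near_eq_cvg _ _ (nbhs x)).
  by apply: filterS (On x Ox) => y /fg ->.
move=> [df Df]; have nfg x : O x -> \forall y \near x, f y = g y.
  by move=> /On; apply: filterS => y /fg.
split=> [x Ox|v]; first exact: near_eq_differentiable (nfg x Ox) (df x Ox).
by apply: IH (Df v) => x Ox; apply: near_eq_derive; exact: nfg.
Qed.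

Lemma CkS W k O (f : 'rV[R]_m -> W) : Ck k.+1 O f -> Ck k O f.
Proof.
elim: k f => [|k IH] f [df Df] /=.
  by move=> x Ox; apply: differentiable_continuous; exact: df.
by split=> // v; exact/IH/Df.
Qed.

Lemma Ck_cst W k O (w : W) : Ck k O (fun=> w).
Proof.
elim: k w => [|k IH] w /=; first by move=> x _; exact: cst_continuous.
split=> [x _|v]; first exact: differentiable_cst.
have -> : 'D_v (fun=> w) = (fun=> 0) :> ('rV[R]_m -> W) => //.
by apply/funext => x; exact: (derive_cst w).
Qed.

Lemma Ck_comp_linear W W' (L : {linear W -> W'}) k O (f : 'rV[R]_m -> W) :
  continuous L -> open O -> Ck k O f -> Ck k O (fun x => L (f x)).
Proof.
move=> cL oO; elim: k f => [|k IH] f /=.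
  by move=> cf x Ox; apply: continuous_comp (cf x Ox) _; exact: cL.
move=> [df Df]; have dL y : differentiable L y by exact: linear_differentiable.
have dLf x : O x -> differentiable (fun x => L (f x)) x.
  by move=> Ox; apply: differentiable_comp (df x Ox) _.
split=> // v; apply: Ck_eq (IH _ (Df v)) => // x Ox.
rewrite !deriveE; [|exact: dLf|exact: df].
by rewrite (@diff_comp _ _ _ _ f L) //= ?diff_lin //; exact: df.
Qed.

Lemma CkD W k O (f g : 'rV[R]_m -> W) : open O ->
  Ck k O f -> Ck k O g -> Ck k O (fun x => f x + g x).
Proof.
move=> oO; elim: k f g => [|k IH] f g /=.
  by move=> cf cg x Ox; apply: continuousD; [exact: cf|exact: cg].
move=> [df Df] [dg Dg]; split=> [x Ox|v].
  by apply: differentiableD; [exact: df|exact: dg].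
apply: Ck_eq (IH _ _ (Df v) (Dg v)) => // x Ox.
by rewrite (@deriveD _ _ _ f g) //; apply: diff_derivable; [exact: df|exact: dg].
Qed.

Lemma Ck_scale W k O (f : 'rV[R]_m -> R^o) (g : 'rV[R]_m -> W) : open O ->
  Ck k O f -> Ck k O g -> Ck k O (fun x => f x *: g x).
Proof.
move=> oO; elim: k f g => [|k IH] f g fk gk.
  by move=> x Ox; apply: continuousZ; [exact: fk|exact: gk].
have [df Df] := fk; have [dg Dg] := gk.
(* The product rule mixes derivatives with undifferentiated factors, so the induction hypothesis
   also needs [f] and [g] at the lower order. *)
have {}fk := CkS fk; have {}gk := CkS gk.
have dfg x : O x -> _ := fun Ox => differentiable_scale (df x Ox) (dg x Ox).
split=> [x Ox|v]; first by have [] := dfg x Ox.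
apply: (@Ck_eq _ _ _ (fun x => f x *: 'D_v g x + 'D_v f x *: g x)) => //.
  move=> x Ox; have [d dE] := dfg x Ox; rewrite [RHS]deriveE // dE.
  by rewrite !deriveE //; [apply: df|apply: dg].
by apply: (@CkD _ _ _ (fun x => f x *: 'D_v g x) (fun x => 'D_v f x *: g x));
  rewrite //; apply: IH; rewrite //; [exact: Dg|exact: Df].
Qed.

Lemma Ck_sum W k O (I : Type) (r : seq I) (P : pred I) (f : I -> 'rV[R]_m -> W) :
  open O -> (forall i, P i -> Ck k O (f i)) ->
  Ck k O (fun x => \sum_(i <- r | P i) f i x).
Proof.
move=> oO fk; elim: r => [|i r IH].
  by apply: Ck_eq (Ck_cst k O (0 : W)) => // x _; rewrite big_nil.
case Pi: (P i); last by apply: Ck_eq IH => // x _; rewrite big_cons Pi.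
by apply: Ck_eq (CkD oO (fk i Pi) IH) => // x _; rewrite big_cons Pi.
Qed.

Lemma Ck_comp W n k O (O' : set 'rV[R]_n) (f : 'rV[R]_m -> 'rV[R]_n)
    (g : 'rV[R]_n -> W) : open O -> (forall x, O x -> O' (f x)) ->
  Ck k O f -> Ck k O' g -> Ck k O (fun x => g (f x)).
Proof.
move=> oO fO; elim: k g => [|k IH] g fk gk.
  move=> x Ox; apply: continuous_comp; first exact: fk.
  by apply: gk; exact: fO.
have [df Df] := fk; have [dg Dg] := gk.
split=> [x Ox|v].
  by apply: differentiable_comp; [exact: df|apply: dg; exact: fO].
(* The direction ['D_v f x] varies with [x], while [Ck] speaks of fixed directions: the chain rule
   is expanded in the standard basis. *)
apply: (@Ck_eq _ _ _ (fun x => \sum_j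
    ('D_v f x : 'rV[R]_n) 0 j *: 'D_(delta_mx 0 j) g (f x))) => //.
  move=> x Ox; have dfx := df x Ox; have dgx := dg _ (fO x Ox).
  rewrite [RHS]deriveE; last exact: differentiable_comp.
  rewrite (diff_comp dfx dgx) /= -(deriveE v dfx).
  rewrite [in RHS](row_sum_delta ('D_v f x)) linear_sum.
  by apply: eq_bigr => j _; rewrite linearZ_LR (deriveE _ dgx).
apply: Ck_sum => // j _; apply: Ck_scale => //; last first.
  by apply: (IH ('D_(delta_mx 0 j) g)); [exact: CkS|exact: Dg].
exact: (@Ck_comp_linear 'rV[R]_n R^o (mxentry 0 j : {linear _ -> _}) k O
  ('D_v f) (@mx_linear_continuous R 1 n R^o (mxentry 0 j)) oO (Df v)).
Qed.

End Ck.

(** * Smoothness at a point *)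

(** One neighbourhood serves all orders at once; this makes it an open condition that is stable
    under derivation. *)
Definition smooth_at (R : realType) (m : nat) (W : normedModType R)
    (f : 'rV[R]_m -> W) (x : 'rV[R]_m) : Prop :=
  exists2 O, open_nbhs x O & smooth_on O f.

Section SmoothAt.
Context {R : realType} {m : nat}.
Implicit Types (W : normedModType R) (O : set 'rV[R]_m) (x v : 'rV[R]_m).

Lemma smooth_on_at W O (f : 'rV[R]_m -> W) x :
  open O -> smooth_on O f -> O x -> smooth_at f x.
Proof. by move=> oO sf Ox; exists O. Qed.

Lemma smooth_at_on W O (f : 'rV[R]_m -> W) :
  (forall x, O x -> smooth_at f x) -> smooth_on O f.
Proof.
move=> sf k.
(* Fixing the order [k] weakens the hypothesis to the form that is inherited by directional
   derivatives in the induction. *)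
have : forall x, O x -> exists2 O', open_nbhs x O' & Ck k O' f.
  by move=> x /sf[ O' xO' kO']; exists O'.
elim: k f {sf} => [|k IH] f sf /=.
  by move=> x /sf[ O' [_ xO'] h]; exact: h.
split=> [x /sf[ O' [_ xO'] [h _]]|v]; first exact: h.
by apply: IH => x /sf[ O' xO' [_ h]]; exists O' => //; exact: h.
Qed.

Lemma smooth_at_near_eq W (f g : 'rV[R]_m -> W) x :
  (\forall y \near x, f y = g y) -> smooth_at f x -> smooth_at g x.
Proof.
move=> fg; have : nbhs x [set y | f y = g y] by [].
rewrite nbhsE => -[N [oN Nx] NE] [ O [oO Ox] sf].
have oNO : open (N `&` O) by exact: openI.
exists (N `&` O) => // k.
apply: (@Ck_eq _ _ _ _ _ f) => //; first by move=> y [/NE].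
by apply: Ck_sub (sf k) => y [].
Qed.

Lemma near_smooth_at W (f : 'rV[R]_m -> W) x :
  smooth_at f x -> \forall y \near x, smooth_at f y.
Proof.
move=> [ O [oO Ox] sf]; apply: (@filterS _ (nbhs x) _ O).
  by move=> y Oy; exists O.
exact: open_nbhs_nbhs.
Qed.

Lemma smooth_at_ext W (f g : 'rV[R]_m -> W) x :
  f =1 g -> smooth_at f x -> smooth_at g x.
Proof. by move=> /funext ->. Qed.

Lemma smooth_at_differentiable W (f : 'rV[R]_m -> W) x :
  smooth_at f x -> differentiable f x.
Proof. by move=> [ O [oO Ox] sf]; have [df _] := sf 1%N; exact: df. Qed.

Lemma smooth_at_continuous W (f : 'rV[R]_m -> W) x :
  smooth_at f x -> {for x, continuous f}.
Proof. by move=> /smooth_at_differentiable /differentiable_continuous. Qed.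

Lemma near_differentiable W (f : 'rV[R]_m -> W) x :
  smooth_at f x -> \forall y \near x, differentiable f y.
Proof.
by move=> /near_smooth_at; apply: filterS => y /smooth_at_differentiable.
Qed.

Lemma smooth_at_derive W (f : 'rV[R]_m -> W) x v :
  smooth_at f x -> smooth_at ('D_v f) x.
Proof. by move=> [ O xO sf]; exists O => // k; have [_ Df] := sf k.+1;
  exact: Df. Qed.

Lemma smooth_at_cst W (w : W) x : smooth_at (fun=> w) x.
Proof. by exists setT; [exact: open_nbhsT|move=> k; exact: Ck_cst]. Qed.

Lemma smooth_at_comp_linear W W' (L : {linear W -> W'}) (f : 'rV[R]_m -> W) x :
  continuous L -> smooth_at f x -> smooth_at (fun x => L (f x)) x.
Proof.
by move=> cL [ O [oO Ox] sf]; exists O => // k; exact: Ck_comp_linear.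
Qed.

Lemma smooth_at_id x : smooth_at id x.
Proof.
exists setT; first exact: open_nbhsT.
case=> [|k] /=; first by move=> y _.
split=> [y _|v] //; rewrite (_ : 'D_v id = fun=> v); first exact: Ck_cst.
by apply/funext => y; exact: derive_id.
Qed.

Let smooth_at2 W1 W2 W (f : 'rV[R]_m -> W1) (g : 'rV[R]_m -> W2)
    (h : 'rV[R]_m -> W) x :
  (forall k O, open O -> Ck k O f -> Ck k O g -> Ck k O h) ->
  smooth_at f x -> smooth_at g x -> smooth_at h x.
Proof.
move=> H [ O [oO Ox] sf] [ O' [oO' Ox'] sg]; exists (O `&` O').
  by split => //; exact: openI.
move=> k; apply: H; first exact: openI.
  by apply: Ck_sub (sf k) => y [].
by apply: Ck_sub (sg k) => y [].
Qed.

Lemma smooth_atD W (f g : 'rV[R]_m -> W) x :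
  smooth_at f x -> smooth_at g x -> smooth_at (fun x => f x + g x) x.
Proof. by apply: smooth_at2 => k O oO; exact: CkD. Qed.

Lemma smooth_at_scale W (f : 'rV[R]_m -> R^o) (g : 'rV[R]_m -> W) x :
  smooth_at f x -> smooth_at g x -> smooth_at (fun x => f x *: g x) x.
Proof. by apply: smooth_at2 => k O oO; exact: Ck_scale. Qed.

Lemma smooth_at_sum W (I : Type) (r : seq I) (P : pred I)
    (f : I -> 'rV[R]_m -> W) x :
  (forall i, P i -> smooth_at (f i) x) ->
  smooth_at (fun x => \sum_(i <- r | P i) f i x) x.
Proof.
move=> sf; elim: r => [|i r IH].
  apply: smooth_at_ext (smooth_at_cst (0 : W) x) => y.
  by rewrite big_nil.
case Pi: (P i); last first.
  by apply: smooth_at_ext IH => y; rewrite big_cons Pi.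
apply: smooth_at_ext (smooth_atD (sf i Pi) IH) => y.
by rewrite big_cons Pi.
Qed.

Lemma smooth_atN W (f : 'rV[R]_m -> W) x :
  smooth_at f x -> smooth_at (fun x => - f x) x.
Proof.
move=> /(smooth_at_scale (smooth_at_cst (-1 : R^o) x)); apply: smooth_at_ext.
by move=> y; rewrite scaleN1r.
Qed.

Lemma smooth_atB W (f g : 'rV[R]_m -> W) x :
  smooth_at f x -> smooth_at g x -> smooth_at (fun x => f x - g x) x.
Proof. by move=> sf /smooth_atN; exact: smooth_atD. Qed.

Lemma smooth_at_comp n W (f : 'rV[R]_m -> 'rV[R]_n) (g : 'rV[R]_n -> W) x :
  smooth_at f x -> smooth_at g (f x) -> smooth_at (fun x => g (f x)) x.
Proof.
move=> [ O [oO Ox] sf] [ O' [oO' Ox'] sg].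
have oi : open (O `&` (O `&` f @^-1` O')).
  rewrite openE => y [Oy [_ Oy']].
  have cf : {for y, continuous f} by apply: (sf 0%N).
  have : \forall z \near y, O' (f z).
    by apply: (near_comp cf); exact: open_nbhs_nbhs.
  have : \forall z \near y, O z by exact: open_nbhs_nbhs.
  by apply: filterS2 => z Oz Oz'.
exists (O `&` (O `&` f @^-1` O')) => // k.
apply: (@Ck_comp _ _ _ _ _ _ O') => //; first by move=> y [_ []].
by apply: Ck_sub (sf k) => y [].
Qed.

Lemma smooth_at_mx a b (f : 'rV[R]_m -> 'M[R]_(a, b)) x :
  (forall i j, smooth_at (fun x => f x i j : R^o) x) -> smooth_at f x.
Proof.
move=> sf.
apply: (@smooth_at_ext _ (fun x => \sum_i \sum_j f x i j *: delta_mx i j)).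
  by move=> y; rewrite -matrix_sum_delta.
apply: smooth_at_sum => i _; apply: smooth_at_sum => j _.
by apply: smooth_at_scale; [exact: sf|exact: smooth_at_cst].
Qed.

Lemma smooth_at_entry a b (f : 'rV[R]_m -> 'M[R]_(a, b)) i j x :
  smooth_at f x -> smooth_at (fun x => f x i j : R^o) x.
Proof. exact: (smooth_at_comp_linear (@mx_linear_continuous _ _ _ _ (mxentry i j))). Qed.

Lemma diff_sum_delta W (f : 'rV[R]_m -> W) x v : differentiable f x ->
  'd f x v = \sum_j v 0 j *: 'D_(delta_mx 0 j) f x.
Proof.
move=> df; rewrite [in LHS](row_sum_delta v) linear_sum.
by apply: eq_bigr => j _; rewrite linearZ_LR deriveE.
Qed.

Lemma diff_near_eq W (f g : 'rV[R]_m -> W) x v : differentiable f x ->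
  (\forall y \near x, f y = g y) -> 'd f x v = 'd g x v.
Proof.
move=> df fg; have dg : differentiable g x by exact: near_eq_differentiable df.
by rewrite -!deriveE //; exact: near_eq_derive.
Qed.

Lemma smooth_at_mulmxr a b (f : 'rV[R]_m -> 'M[R]_(1, a)) (K : 'M[R]_(a, b)) x :
  smooth_at f x -> smooth_at (fun x => f x *m K) x.
Proof.
exact: (smooth_at_comp_linear (@mx_linear_continuous _ _ _ _ (mulmxr K))).
Qed.

Lemma diff_sum W (I : Type) (r : seq I) (f : I -> 'rV[R]_m -> W) x v :
  (forall i, differentiable (f i) x) ->
  'd (fun y => \sum_(i <- r) f i y) x v = \sum_(i <- r) 'd (f i) x v.
Proof.
move=> df.
suff [] : differentiable (fun y => \sum_(i <- r) f i y) x /\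
  'd (fun y => \sum_(i <- r) f i y) x v = \sum_(i <- r) 'd (f i) x v by [].
elim: r => [|i r [IH1 IH2]].
  rewrite (_ : (fun y => _) = cst 0); last first.
    by apply/funext => y; rewrite big_nil.
  by rewrite diff_cst big_nil; split=> //; exact: differentiable_cst.
rewrite (_ : (fun y => _) = f i + (fun y => \sum_(i <- r) f i y)); last first.
  by apply/funext => y; rewrite big_cons.
split; first exact: differentiableD (df i) IH1.
by rewrite (diffD (df i) IH1) big_cons -IH2.
Qed.

Lemma derive_entry a b (f : 'rV[R]_m -> 'M[R]_(a, b)) i j x v :
  differentiable f x -> ('D_v f x) i j = 'D_v (fun y => f y i j : R^o) x.
Proof. by move=> df; rewrite derive_mx ?mxE //; exact: diff_derivable. Qed.

End SmoothAt.

(** * Derivatives along moving points and directions *)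

Section Composition.
Context {R : realType} {m n : nat}.
Implicit Types (W : normedModType R).

Lemma smooth_at_diff W (f : 'rV[R]_n -> W) (p q : 'rV[R]_m -> 'rV[R]_n) x :
  smooth_at f (p x) -> smooth_at p x -> smooth_at q x ->
  smooth_at (fun x => 'd f (p x) (q x)) x.
Proof.
move=> sf sp sq.
apply: (@smooth_at_near_eq _ _ _
    (fun x => \sum_j q x 0 j *: 'D_(delta_mx 0 j) f (p x))).
  have : \forall y \near x, differentiable f (p y).
    exact: near_comp (smooth_at_continuous sp) (near_differentiable sf).
  by apply: filterS => y /diff_sum_delta ->.
apply: smooth_at_sum => j _; apply: smooth_at_scale.
  exact: smooth_at_entry.
exact: smooth_at_comp sp (smooth_at_derive _ sf).
Qed.

(** Expanding ['d f (p y) (q y)] in partial derivatives of [f] and applying the product rule, the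
    derivatives of the coefficients [q] give the first-order term and those of the partial
    derivatives the second-order one. *)
Lemma diff_diff W (f : 'rV[R]_n -> W) (p q : 'rV[R]_m -> 'rV[R]_n) x w :
  smooth_at f (p x) -> smooth_at p x -> smooth_at q x ->
  'd (fun y => 'd f (p y) (q y)) x w =
  'D_('d p x w) ('D_(q x) f) (p x) + 'd f (p x) ('d q x w).
Proof.
move=> sf sp sq.
have dp := smooth_at_differentiable sp; have dq := smooth_at_differentiable sq.
have sDf j : smooth_at ('D_(delta_mx 0 j) f) (p x) by exact: smooth_at_derive.
have nE : \forall y \near x,
    \sum_j q y 0 j *: 'D_(delta_mx 0 j) f (p y) = 'd f (p y) (q y).
  have : \forall y \near x, differentiable f (p y).
    exact: near_comp (smooth_at_continuous sp) (near_differentiable sf).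
  by apply: filterS => y /diff_sum_delta ->.
have dqj j : smooth_at (fun y => q y 0 j : R^o) x by exact: smooth_at_entry.
have dDp j : smooth_at (fun y => 'D_(delta_mx 0 j) f (p y)) x.
  exact: smooth_at_comp sp (sDf j).
have sS j : smooth_at (fun y => q y 0 j *: 'D_(delta_mx 0 j) f (p y)) x.
  exact: smooth_at_scale.
have dS j := smooth_at_differentiable (sS j).
rewrite -(@diff_near_eq _ _ _
  (fun y => \sum_j q y 0 j *: 'D_(delta_mx 0 j) f (p y))) //; last first.
  by apply: smooth_at_differentiable; exact: smooth_at_sum.
rewrite diff_sum //.
(* The second derivative is expanded in the same basis; here the coefficients are frozen at [x], so
   they contribute no derivative. *)
rewrite [X in _ = X + _](_ : _ = \sum_j q x 0 j *:
    'D_('d p x w) ('D_(delta_mx 0 j) f) (p x)); last first.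
  rewrite (@near_eq_derive _ _ _ _ (fun y => \sum_j q x 0 j *:
    'D_(delta_mx 0 j) f y)); last first.
    apply: filterS (near_differentiable sf) => y dfy.
    by rewrite deriveE // diff_sum_delta.
  rewrite deriveE; last first.
    apply: smooth_at_differentiable; apply: smooth_at_sum => j _.
    by apply: smooth_at_scale => //; exact: smooth_at_cst.
  rewrite diff_sum; last first.
    move=> j; apply: smooth_at_differentiable.
    by apply: smooth_at_scale => //; exact: smooth_at_cst.
  apply: eq_bigr => j _.
  by rewrite diffZ ?deriveE //; apply: smooth_at_differentiable.
rewrite (diff_sum_delta _ (smooth_at_differentiable sf)) -big_split.
apply: eq_bigr => j _ /=.
have [_ ->] := differentiable_scale (smooth_at_differentiable (dqj j))
  (smooth_at_differentiable (dDp j)).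
congr (_ *: _ + _ *: _).
  rewrite (@diff_comp _ _ _ _ p ('D_(delta_mx 0 j) f)) //=.
    by rewrite -deriveE //; exact: smooth_at_differentiable.
  exact: smooth_at_differentiable.
rewrite -deriveE; last exact: smooth_at_differentiable.
by rewrite -derive_entry // deriveE.
Qed.

End Composition.

Section DirectionalDerivative.
Context {R : realType} {m n : nat}.
Implicit Types (W : normedModType R).

Lemma derive_compE W (f : 'rV[R]_m -> 'rV[R]_n) (g : 'rV[R]_n -> W) x w :
  differentiable f x -> differentiable g (f x) ->
  'D_w (fun y => g (f y)) x = 'D_('D_w f x) g (f x).
Proof.
move=> df dg; rewrite (deriveE w df) (deriveE _ dg).
have := diff_comp df dg => /(congr1 (@^~ w)) /= <-.
by rewrite deriveE //; exact: differentiable_comp.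
Qed.

Lemma derive_linear W (f : 'rV[R]_m -> W) x a u v : differentiable f x ->
  'D_(a *: u + v) f x = a *: 'D_u f x + 'D_v f x.
Proof. by move=> df; rewrite !deriveE // linearP. Qed.

Lemma derive_scale W (f : 'rV[R]_m -> R^o) (g : 'rV[R]_m -> W) x v :
  differentiable f x -> differentiable g x ->
  'D_v (fun y => f y *: g y) x = f x *: 'D_v g x + 'D_v f x *: g x.
Proof.
move=> df dg; have [dfg dE] := differentiable_scale df dg.
by rewrite (deriveE v dfg) (deriveE v df) (deriveE v dg); exact: dE.
Qed.

Lemma smooth_at_derive_along W (f : 'rV[R]_n -> W) (p q : 'rV[R]_m -> 'rV[R]_n) x :
  smooth_at f (p x) -> smooth_at p x -> smooth_at q x ->
  smooth_at (fun y => 'D_(q y) f (p y)) x.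
Proof.
move=> sf sp sq; apply: smooth_at_near_eq (smooth_at_diff sf sp sq).
have : \forall y \near x, differentiable f (p y).
  exact: near_comp (smooth_at_continuous sp) (near_differentiable sf).
by apply: filterS => y /(deriveE (q y)).
Qed.

Lemma derive_along W (f : 'rV[R]_n -> W) (p q : 'rV[R]_m -> 'rV[R]_n) x w :
  smooth_at f (p x) -> smooth_at p x -> smooth_at q x ->
  'D_w (fun y => 'D_(q y) f (p y)) x =
  'D_('D_w p x) ('D_(q x) f) (p x) + 'D_('D_w q x) f (p x).
Proof.
move=> sf sp sq.
have dp := smooth_at_differentiable sp; have dq := smooth_at_differentiable sq.
have df := smooth_at_differentiable sf.
rewrite (deriveE _ df) (deriveE _ dp) (deriveE _ dq) -(diff_diff w sf sp sq).
rewrite -deriveE; last by apply/smooth_at_differentiable/smooth_at_diff.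
apply: near_eq_derive.
have : \forall y \near x, differentiable f (p y).
  exact: near_comp (smooth_at_continuous sp) (near_differentiable sf).
by apply: filterS => y /(deriveE (q y)).
Qed.

End DirectionalDerivative.

(** * Symmetry of second derivatives *)

Section Schwarz.
Context {R : realType} {m : nat}.
Implicit Types (f : 'rV[R]_m -> R^o) (x u v : 'rV[R]_m).

Lemma line_MVT f x v (h : R) : 0 < h ->
  (forall t, 0 <= t <= h -> differentiable f (x + t *: v)) ->
  exists2 c, 0 <= c <= h & f (x + h *: v) - f x = h * 'D_v f (x + c *: v).
Proof.
move=> h0 df.
pose g (t : R) : R := f (x + t *: v).
(* The difference quotients of [g] at [t] are literally those of [f] at [x + t *: v] in the
   direction [v]. *)
have E t : (fun s : R => s^-1 *: ((g \o shift t) (s *: (1 : R)) - g t)) =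
    (fun s => s^-1 *: ((f \o shift (x + t *: v)) (s *: v) - f (x + t *: v))).
  apply/funext => s; rewrite /g /=; congr (_ *: (f _ - _)).
  by rewrite [_%:A]mulr1 scalerDl addrCA.
have dg t : 0 <= t <= h -> is_derive t 1 g ('D_v f (x + t *: v)).
  move=> th; split; last by rewrite /derive E.
  by rewrite /derivable E; apply: diff_derivable; exact: df.
have [||c ch gE] := @MVT_segment R g (fun t => 'D_v f (x + t *: v)) 0 h (ltW h0).
- move=> t; rewrite in_itv /= => /andP[t0 th]; apply: dg.
  by rewrite (ltW t0) (ltW th).
- apply: derivable_within_continuous => t; rewrite in_itv /= => th.
  by have [] := dg t th.
exists c; first by move: ch; rewrite in_itv.
by move: gE; rewrite /g scale0r addr0 subr0 mulrC.
Qed.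

Lemma derive_translate f k y w :
  'D_w (fun y => f (y + k)) y = 'D_w f (y + k).
Proof.
rewrite {1}/derive (_ : (fun h => _) = (fun h : R =>
  h^-1 *: ((f \o shift (y + k)) (h *: w) - f (y + k)))) //.
by apply/funext => h /=; rewrite addrA.
Qed.

(** The mean value theorem is applied along [u] to [y |-> f (y + h *: v) - f y], then along [v] to
    ['D_u f]. *)
Lemma second_difference f x u v (h : R) : 0 < h ->
  (forall s t, 0 <= s <= h -> 0 <= t <= h ->
    smooth_at f (x + s *: u + t *: v)) ->
  exists c d, [/\ 0 <= c <= h, 0 <= d <= h &
    f (x + h *: u + h *: v) - f (x + h *: u) - f (x + h *: v) + f x =
    h * (h * 'D_v ('D_u f) (x + c *: u + d *: v))].
Proof.
move=> h0 sf.
have df s t sh th := smooth_at_differentiable (sf s t sh th).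
have h00 : 0 <= (0 : R) <= h by rewrite lexx ltW.
have hh : 0 <= h <= h by rewrite lexx ltW.
have df0 s : 0 <= s <= h -> differentiable f (x + s *: u).
  by move=> sh; have := df s 0 sh h00; rewrite scale0r addr0.
pose F y : R^o := f (y + h *: v) - f y.
have dsh y : differentiable f (y + h *: v) ->
    differentiable (fun y => f (y + h *: v)) y.
  have dd : differentiable (fun y => y + h *: v) y by [].
  exact: (differentiable_comp dd).
have dF s : 0 <= s <= h -> differentiable F (x + s *: u).
  move=> sh; apply: differentiableB; last exact: df0.
  exact: dsh _ (df s h sh hh).
have [c ch Fc] := line_MVT h0 dF.
have : forall t, 0 <= t <= h -> differentiable ('D_u f) (x + c *: u + t *: v).
  by move=> t th; apply/smooth_at_differentiable/smooth_at_derive/sf.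
move=> /(line_MVT h0)[d dh Dd].
exists c, d; split=> //; rewrite -Dd.
transitivity (F (x + h *: u) - F x); first by rewrite /F; ring.
rewrite Fc; congr (h * _).
rewrite (@deriveB _ _ _ (fun y => f (y + h *: v)) f).
- by rewrite derive_translate.
- exact/diff_derivable/dsh/df.
- exact/diff_derivable/df0.
Qed.

Lemma near_parallelogram x u v (P : 'rV[R]_m -> Prop) : (\forall y \near x, P y) ->
  exists2 h : R, 0 < h & forall s t, 0 <= s <= h -> 0 <= t <= h ->
    P (x + s *: u + t *: v).
Proof.
move=> /nbhs_ballP[e /= e0 eP].
have k0 : 0 < `|u| + `|v| + 1 by rewrite ltr_pwDr // addr_ge0.
(* The summand 1 keeps the denominator positive when [u] and [v] vanish; the half leaves the
   displacement strictly below [e]. *)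
exists (e / 2 / (`|u| + `|v| + 1)); first by rewrite !divr_gt0.
move=> s t /andP[s0 sh] /andP[t0 th]; apply: eP.
rewrite -ball_normE /= -addrA opprD addNKr normrN.
apply: le_lt_trans (ler_normD _ _) _; rewrite !normrZ !ger0_norm //.
apply: (@le_lt_trans _ _ (e / 2 / (`|u| + `|v| + 1) * (`|u| + `|v| + 1))).
  by rewrite !mulrDr -addrA lerD ?ler_wpM2r // ler_wpDr ?ler_wpM2r // mulr1 !divr_ge0 // ltW.
by rewrite divfK ?gt_eqF // ltr_pdivrMr // ltr_pMr // ltr1n.
Qed.

Let dist_lt_add (a b z e : R) : `|a - z| < e -> `|b - z| < e -> `|a - b| < e + e.
Proof.
move=> az bz; rewrite -(subrKA z); apply: le_lt_trans (ler_normD _ _) _.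
by rewrite ltrD // distrC.
Qed.

(** The second difference is symmetric in [u] and [v], so the two mixed derivatives take a common
    value at two points close to [x]; by continuity each is there within half of the supposed gap of
    its value at [x], a contradiction. *)
Lemma derive_comm_real f x u v :
  smooth_at f x -> 'D_u ('D_v f) x = 'D_v ('D_u f) x.
Proof.
move=> sf; apply/eqP; rewrite -subr_eq0; apply/negPn/negP => ne.
set a := 'D_u ('D_v f) x; set b := 'D_v ('D_u f) x.
pose e := `|a - b| / 2.
have e0 : 0 < e by rewrite divr_gt0 // normr_gt0.
have ca : {for x, continuous ('D_u ('D_v f))}.
  exact/smooth_at_continuous/smooth_at_derive/smooth_at_derive.
have cb : {for x, continuous ('D_v ('D_u f))}.
  exact/smooth_at_continuous/smooth_at_derive/smooth_at_derive.
have na : \forall y \near x, `|a - 'D_u ('D_v f) y| < e.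
  by move/cvgr_dist_lt: ca; apply.
have nb : \forall y \near x, `|b - 'D_v ('D_u f) y| < e.
  by move/cvgr_dist_lt: cb; apply.
have [h h0 P] := near_parallelogram u v
  (filterI (filterI na nb) (near_smooth_at sf)).
have [|c [d [ch dh E1]]] := @second_difference f x u v h h0.
  by move=> s t sh th; have [_] := P s t sh th.
have [|c' [d' [ch' dh' E2]]] := @second_difference f x v u h h0.
  by move=> s t sh th; rewrite addrAC; have [_] := P t s th sh.
have AC y z : x + y + z = x + z + y by rewrite addrAC.
have E : 'D_u ('D_v f) (x + d' *: u + c' *: v) =
    'D_v ('D_u f) (x + c *: u + d *: v).
  apply: (mulfI (lt0r_neq0 h0)); apply: (mulfI (lt0r_neq0 h0)).
  rewrite [x + d' *: u + c' *: v]AC; apply: etrans (esym E2) _.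
  apply: etrans _ E1; rewrite [x + h *: v + h *: u]AC.
  by congr (_ + _); exact: addrAC.
have [[_ h1] _] := P c d ch dh.
have [[h2 _] _] := P d' c' dh' ch'.
have : `|a - b| < e + e.
  by apply: dist_lt_add h1; rewrite -E.
by rewrite /e -splitr ltxx.
Qed.

Lemma derive_comm a b (f : 'rV[R]_m -> 'M[R]_(a, b)) x u v :
  smooth_at f x -> 'D_u ('D_v f) x = 'D_v ('D_u f) x.
Proof.
move=> sf; apply/matrixP => i j.
have E w w' : 'D_w ('D_w' f) x i j =
    'D_w ('D_w' (fun y => f y i j : R^o)) x.
  rewrite derive_entry; last first.
    exact/smooth_at_differentiable/smooth_at_derive.
  apply: near_eq_derive; apply: filterS (near_differentiable sf) => y.
  exact: derive_entry.
have C := derive_comm_real u v (smooth_at_entry i j sf).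
apply: (eq_trans (E u v)).
apply: (eq_trans C).
by apply: esym; apply: E.
Qed.

End Schwarz.

(** * Row vectors in two blocks and tangent maps *)

Section BlockVectors.
Context {R : realType} {k : nat}.
Implicit Types x w : 'rV[R]_k.

Lemma smooth_at_row_mx a b (f : 'rV[R]_k -> 'rV[R]_a) (g : 'rV[R]_k -> 'rV[R]_b) x :
  smooth_at f x -> smooth_at g x -> smooth_at (fun y => row_mx (f y) (g y)) x.
Proof.
move=> sf sg; apply: smooth_at_mx => i j; case: (split_ordP j) => l ->.
  apply: (@smooth_at_ext _ _ R^o (fun y => f y i l)) => [y|].
    by rewrite row_mxEl.
  exact: smooth_at_entry.
apply: (@smooth_at_ext _ _ R^o (fun y => g y i l)) => [y|].
  by rewrite row_mxEr.
exact: smooth_at_entry.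
Qed.

Lemma derive_row_mx a b (f : 'rV[R]_k -> 'rV[R]_a) (g : 'rV[R]_k -> 'rV[R]_b) x w :
  smooth_at f x -> smooth_at g x ->
  'D_w (fun y => row_mx (f y) (g y)) x = row_mx ('D_w f x) ('D_w g x).
Proof.
move=> sf sg; apply/rowP => j.
rewrite derive_entry; last exact/smooth_at_differentiable/smooth_at_row_mx.
case: (split_ordP j) => l ->; rewrite ?row_mxEl ?row_mxEr.
  rewrite derive_entry; last exact: smooth_at_differentiable.
  by congr ('D_w _ x); apply/funext => y; rewrite row_mxEl.
rewrite derive_entry; last exact: smooth_at_differentiable.
by congr ('D_w _ x); apply/funext => y; rewrite row_mxEr.
Qed.

Lemma derive_mx_linear l (W : normedModType R)
    (L : {linear 'rV[R]_l -> W}) (x w : 'rV[R]_l) : 'D_w L x = L w.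
Proof.
have cL := @mx_linear_continuous R _ _ W L.
by rewrite deriveE ?diff_lin //; exact: linear_differentiable.
Qed.

Lemma smooth_at_linear l (W : normedModType R)
    (L : {linear 'rV[R]_l -> W}) (x : 'rV[R]_l) : smooth_at L x.
Proof.
exact: (smooth_at_comp_linear (@mx_linear_continuous R _ _ W L) (smooth_at_id x)).
Qed.

Lemma derive_mulmxr a b (f : 'rV[R]_k -> 'rV[R]_a) (K : 'M[R]_(a, b)) x w :
  smooth_at f x -> 'D_w (fun y => f y *m K) x = 'D_w f x *m K.
Proof.
move=> sf; have sK := smooth_at_linear (mulmxr K : {linear 'rV_a -> 'rV_b}) (f x).
rewrite (derive_compE w (smooth_at_differentiable sf) (smooth_at_differentiable sK)).
exact: derive_mx_linear (mulmxr K : {linear 'rV_a -> 'rV_b}) _ _.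
Qed.

(** Takes a bare function with a proof of linearity, since coordinate expressions of an endomorphism
    carry no linear structure of their own. *)
Lemma linear_mulmxE a b (L : 'rV[R]_a -> 'rV[R]_b) (u : 'rV[R]_a) :
  (forall (t : R) (v v' : 'rV[R]_a), L (t *: v + v') = t *: L v + L v') ->
  L u = u *m \matrix_(i, j) L (delta_mx 0 i) 0 j.
Proof.
move=> linL; pose Lm := GRing.isLinear.Build R _ _ _ L linL.
pose L' : {linear 'rV[R]_a -> 'rV[R]_b} := HB.pack L Lm.
rewrite -[L u]/(L' u) -mul_rV_lin1; congr (u *m _).
by apply/matrixP => i j; rewrite !mxE.
Qed.

End BlockVectors.

(** The tangent map of [f] in coordinates, a point being followed by a tangent vector at it; induced
    charts of the bundle change by such maps. *)
Definition tlift (R : realType) m (f : 'rV[R]_m -> 'rV[R]_m) :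
    'rV[R]_(m + m) -> 'rV[R]_(m + m) :=
  fun z => row_mx (f (lsubmx z)) ('D_(rsubmx z) f (lsubmx z)).

Section Tlift.
Context {R : realType} {m : nat}.
Implicit Types (x v a b : 'rV[R]_m) (W : normedModType R).

Lemma smooth_at_lsubmx (z : 'rV[R]_(m + m)) :
  smooth_at (lsubmx : 'rV[R]_(m + m) -> 'rV[R]_m) z.
Proof. exact: (@smooth_at_linear R _ _ (lsubmx : {linear 'rV[R]_(m + m)
  -> 'rV[R]_m})). Qed.

Lemma smooth_at_rsubmx (z : 'rV[R]_(m + m)) :
  smooth_at (rsubmx : 'rV[R]_(m + m) -> 'rV[R]_m) z.
Proof. exact: (@smooth_at_linear R _ _ (rsubmx : {linear 'rV[R]_(m + m)
  -> 'rV[R]_m})). Qed.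

Lemma derive_lsubmx (z w : 'rV[R]_(m + m)) :
  'D_w (lsubmx : 'rV[R]_(m + m) -> 'rV[R]_m) z = lsubmx w.
Proof. exact: (@derive_mx_linear R _ _ (lsubmx : {linear 'rV[R]_(m + m)
  -> 'rV[R]_m})). Qed.

Lemma derive_rsubmx (z w : 'rV[R]_(m + m)) :
  'D_w (rsubmx : 'rV[R]_(m + m) -> 'rV[R]_m) z = rsubmx w.
Proof. exact: (@derive_mx_linear R _ _ (rsubmx : {linear 'rV[R]_(m + m)
  -> 'rV[R]_m})). Qed.

Lemma smooth_at_base W (f : 'rV[R]_m -> W) (z : 'rV[R]_(m + m)) :
  smooth_at f (lsubmx z) -> smooth_at (fun y => f (lsubmx y)) z.
Proof. by move=> sf; exact: smooth_at_comp (smooth_at_lsubmx z) sf. Qed.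

Lemma smooth_at_fiber W (f : 'rV[R]_m -> W) (z : 'rV[R]_(m + m)) :
  smooth_at f (lsubmx z) ->
  smooth_at (fun y => 'D_(rsubmx y) f (lsubmx y)) z.
Proof.
move=> sf; exact: smooth_at_derive_along sf (smooth_at_lsubmx z)
  (smooth_at_rsubmx z).
Qed.

Lemma derive_base W (f : 'rV[R]_m -> W) (z w : 'rV[R]_(m + m)) :
  smooth_at f (lsubmx z) ->
  'D_w (fun y => f (lsubmx y)) z = 'D_(lsubmx w) f (lsubmx z).
Proof.
move=> sf; rewrite -(derive_lsubmx z w).
exact: derive_compE (smooth_at_differentiable (smooth_at_lsubmx z))
  (smooth_at_differentiable sf).
Qed.

Lemma derive_fiber W (f : 'rV[R]_m -> W) (z w : 'rV[R]_(m + m)) :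
  smooth_at f (lsubmx z) ->
  'D_w (fun y => 'D_(rsubmx y) f (lsubmx y)) z =
  'D_(lsubmx w) ('D_(rsubmx z) f) (lsubmx z) + 'D_(rsubmx w) f (lsubmx z).
Proof.
move=> sf; have := derive_along w sf (smooth_at_lsubmx z) (smooth_at_rsubmx z).
by rewrite derive_lsubmx derive_rsubmx.
Qed.

Lemma smooth_at_tlift (f : 'rV[R]_m -> 'rV[R]_m) z :
  smooth_at f (lsubmx z) -> smooth_at (tlift f) z.
Proof.
by move=> sf; apply: smooth_at_row_mx; [exact: smooth_at_base|
  exact: smooth_at_fiber].
Qed.

Lemma derive_tlift (f : 'rV[R]_m -> 'rV[R]_m) z w : smooth_at f (lsubmx z) ->
  'D_w (tlift f) z = row_mx ('D_(lsubmx w) f (lsubmx z))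
    ('D_(lsubmx w) ('D_(rsubmx z) f) (lsubmx z) + 'D_(rsubmx w) f (lsubmx z)).
Proof.
move=> sf; have := derive_row_mx w (smooth_at_base sf) (smooth_at_fiber sf).
by rewrite (derive_base _ sf) (derive_fiber _ sf).
Qed.

End Tlift.

(** * Bump functions *)

Section OneVariable.
Context {R : realType} {m : nat}.

(** A class of one-variable functions closed under derivation consists of smooth functions: in the
    induction on the order, the chain rule replaces [h] by a derivative that is again in [H]. *)
Lemma smooth_at_comp_class (D : set R) (H : (R -> R) -> Prop) :
  open D ->
  (forall h, H h -> exists2 h', H h' & forall t, D t -> is_derive t 1 h (h' t)) ->
  forall h, H h -> forall (f : 'rV[R]_m -> R^o) x, D (f x) ->
    smooth_at f x -> smooth_at (fun y => h (f y) : R^o) x.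
Proof.
move=> oD clH h Hh f x Dx [U [oU Ux] sf].
pose O := U `&` f @^-1` D.
have oO : open O.
  rewrite openE => y [Uy Dy].
  have cf : {for y, continuous f} by apply: (sf 0%N).
  have nD : \forall z \near y, D (f z).
    by apply: (near_comp cf); exact: open_nbhs_nbhs.
  have : \forall z \near y, U z by exact: open_nbhs_nbhs.
  by apply: filterS2 nD => z Dz Uz.
exists O => // k.
have {}sf j : Ck j O f by apply: Ck_sub (sf j) => y [].
elim: k h Hh => [|k IH] h Hh; have [h' Hh' dh] := clH h Hh.
  move=> y [Uy Dy]; apply: continuous_comp; first by apply: (sf 0%N).
  by apply: differentiable_continuous; apply/derivable1_diffP; have [] := dh _ Dy.
have [df Df] := sf k.+1.
have dhf y : O y -> differentiable h (f y).
  by move=> [_ Dy]; apply/derivable1_diffP; have [] := dh _ Dy.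
split=> [y Oy|v].
  by apply: (differentiable_comp (df y Oy)); exact: dhf.
apply: (@Ck_eq _ _ R^o k _ (fun y => (h' (f y) : R^o) *: ('D_v f y : R^o))) => //.
  move=> y Oy; have dfy := df y Oy; have dhy := dhf y Oy.
  rewrite [RHS]deriveE; last exact: differentiable_comp dfy dhy.
  rewrite (diff_comp dfy dhy) /= -(deriveE v dfy).
  have [_ Dy] := Oy; have [dhy1 hE] := dh _ Dy.
  rewrite diff1E // -hE derive1E.
  by rewrite /GRing.scale /= mulrC.
apply: Ck_scale => //; first exact: IH.
exact: Df.
Qed.

Lemma smooth_at_inv (f : 'rV[R]_m -> R^o) x : f x != 0 -> smooth_at f x ->
  smooth_at (fun y => (f y)^-1 : R^o) x.
Proof.
move=> fx0 sf.
(* The multiples of powers of the inverse form a class closed under derivation, which the inverse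
   alone is not. *)
pose H (h : R -> R) := exists c n, h = (fun t => c * (t^-1) ^+ n).
apply: (@smooth_at_comp_class [set t | t != 0] H) => //.

- move=> h [c [n ->]]; exists (fun t => (- (c * n%:R)) * (t^-1) ^+ n.+1).
    by exists (- (c * n%:R)), n.+1.
  move=> t /= t0; have dV : is_derive t 1 (fun t : R => t^-1) (- (t^-1) ^+ 2).
    apply: is_derive_eq (is_deriveV t0 (is_derive_id t 1)) _.
    by rewrite [LHS]mulr1 exprVn.
  rewrite (_ : (fun t => _) = c *: ((fun t : R => t^-1) ^+ n)); last first.
    by apply/funext => s; rewrite -[RHS]/(c * _) exprfctE.
  apply: is_derive_eq; rewrite -[LHS]/(c * (n%:R * t^-1 ^+ n.-1 * - t^-1 ^+ 2)).
  by case: n => [|n]; [ring|rewrite /= !exprS; ring].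
- by exists 1, 1%N; apply/funext => t; rewrite mul1r expr1.
Qed.

(** The inequality [v <= expR v] at [v = u / n.+1%:R], raised to the power [n.+1]. *)
Lemma expR_ge_pow (u : R) n : 0 <= u -> u ^+ n.+1 <= n.+1%:R ^+ n.+1 * expR u.
Proof.
move=> u0.
have n0 : (0 : R) < n.+1%:R by [].
have -> : expR u = expR (u / n.+1%:R) ^+ n.+1.
  by rewrite -expRM_natl mulrC divfK // gt_eqF.
rewrite -exprMn lerXn2r ?nnegrE ?mulr_ge0 ?expR_ge0 //.
rewrite mulrC -ler_pdivrMr //; apply: le_trans (expR_ge1Dx _).
by rewrite lerDr.
Qed.

(** The smallest convenient class closed under derivation that contains the classical function
    [exp (-1/t)], extended by 0, which is [expVp 1]. *)
Definition expVp (p : {poly R}) (t : R) : R :=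
  if 0 < t then p.[t^-1] * expR (- t^-1) else 0.

(** The quadratic bound is what forces the derivative 0 at the origin. The constants [N i] come from
    [expR_ge_pow] at the exponent [i.+2]: two powers more than the monomial, to leave [t ^+ 2]. *)
Lemma expVp_le p : exists2 C, 0 <= C & forall t, `|expVp p t| <= C * t ^+ 2.
Proof.
pose N (i : nat) : R := i.+2%:R ^+ i.+2.
have N0 i : 0 <= N i by rewrite exprn_ge0.
exists (\sum_(i < size p) `|p`_i| * N i).
  by apply: sumr_ge0 => i _; rewrite mulr_ge0.
move=> t; rewrite /expVp; case: ifPn => [t0|_]; last first.
  rewrite normr0 mulr_ge0 ?sqr_ge0 //.
  by apply: sumr_ge0 => i _; rewrite mulr_ge0.
rewrite normrM [`|expR _|]ger0_norm ?expR_ge0 // horner_coef.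
apply: (@le_trans _ _ ((\sum_(i < size p) `|p`_i| * t^-1 ^+ i) * expR (- t^-1))).
  rewrite ler_wpM2r ?expR_ge0 //; apply: le_trans (ler_norm_sum _ _ _) _.
  by apply: ler_sum => i _; rewrite normrM normrX [`|t^-1|]ger0_norm // invr_ge0 ltW.
have bnd i : t^-1 ^+ i * expR (- t^-1) <= N i * t ^+ 2.
  rewrite expRN -ler_pdivlMr ?invr_gt0 ?expR_gt0 // invrK [leRHS]mulrAC.
  rewrite -ler_pdivrMr ?exprn_gt0 // -exprVn -exprD addn2; apply: expR_ge_pow.
  by rewrite invr_ge0 ltW.
rewrite !mulr_suml; apply: ler_sum => i _.
by rewrite -mulrA -[leRHS]mulrA ler_wpM2l.
Qed.

(** For [t > 0], differentiating [p (1/t) exp (-1/t)] replaces [p] by [p - p'] and brings out the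
    factor [1/t^2], whence ['X^2]. At 0 the difference quotient is controlled by [expVp_le]. *)
Lemma is_derive_expVp p (t : R) :
  is_derive t 1 (expVp p : R -> R) (expVp ('X^2 * (p - p^`()))%R t).
Proof.
have [t0|t0|->] := ltgtP t 0.
- rewrite /expVp ltNge (ltW t0) /=.
  apply: near_eq_is_derive (is_derive_cst (0 : R) t 1).
  near=> s; rewrite ltNge ltW //=; near: s; exact: lt_nbhsl.
- have t0' : t != 0 by rewrite gt_eqF.
  have dV : is_derive t 1 (fun t : R => t^-1) (- (t^-1) ^+ 2).
    apply: is_derive_eq (is_deriveV t0' (is_derive_id t 1)) _.
    by rewrite [LHS]mulr1 exprVn.
  pose g := ((horner p) \o (fun t : R => t^-1)) *
    (expR \o -%R \o (fun t : R => t^-1)).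
  apply: (@near_eq_is_derive _ _ _ g).
    near=> s; rewrite /expVp ifT //; near: s; exact: lt_nbhsr.
  apply: is_derive_eq; rewrite /expVp t0 /= !hornerE /GRing.scale /=.
  by ring.
- rewrite {2}/expVp ltxx; have [C C0 hC] := expVp_le p.
  have K : (fun h : R => h^-1 *: ((expVp p \o shift 0) (h *: (1 : R)) - expVp p 0))
      @ 0^' --> (0 : R).
    apply/cvgrPdist_le => e e0; near=> h.
    have h0 : h != 0 by near: h; exact: nbhs_dnbhs_neq.
    rewrite sub0r normrN /= addr0 [h *: 1]mulr1 {2}/expVp ltxx subr0.
    rewrite normrM normfV ler_pdivrMl ?normr_gt0 //.
    apply: le_trans (hC h) _; rewrite -real_normK ?num_real // expr2 mulrA.
    rewrite mulrC ler_wpM2l //.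
    (* [C] may be 0 and the bound is about to be divided by the constant. *)
    apply: (@le_trans _ _ ((C + 1) * `|h|)).
      by rewrite ler_wpM2r // lerDl.
    rewrite mulrC -ler_pdivlMr ?ltr_wpDl //.
    by near: h; apply: dnbhs0_le; rewrite divr_gt0 // ltr_wpDl.
  split; last exact: cvg_lim K.
  by apply/cvg_ex; exists 0.
Unshelve. all: by end_near.
Qed.

Lemma smooth_at_expVp p (f : 'rV[R]_m -> R^o) x : smooth_at f x ->
  smooth_at (fun y => expVp p (f y) : R^o) x.
Proof.
pose H (h : R -> R) := exists p, h = expVp p.
apply: (@smooth_at_comp_class setT H) => //; first exact: openT.
  move=> h [q ->]; exists (expVp ('X^2 * (q - q^`()))); first by eexists.
  by move=> t _; exact: is_derive_expVp.
by exists p.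
Qed.

Lemma expVp1_gt0 (t : R) : (0 < expVp 1 t) = (0 < t).
Proof.
rewrite /expVp; have [t0|t0] := boolP (0 < t); last by rewrite ltxx.
by rewrite hornerC mul1r expR_gt0.
Qed.

Lemma expVp1_ge0 (t : R) : 0 <= expVp 1 t.
Proof. by rewrite /expVp; case: ifP => // _; rewrite hornerC mul1r expR_ge0. Qed.

Lemma expVp_eq0 p (t : R) : t <= 0 -> expVp p t = 0.
Proof. by rewrite /expVp leNgt => /negbTE ->. Qed.

Lemma smooth_atM (f g : 'rV[R]_m -> R^o) x : smooth_at f x -> smooth_at g x ->
  smooth_at (fun y => f y * g y : R^o) x.
Proof. exact: smooth_at_scale. Qed.

(** The quotient [a / (a + b)], with [q] the squared Euclidean distance, a polynomial: [a] vanishes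
    for [q >= e^2], [b] for [q <= e^2 / 2], and these ranges are disjoint, so the denominator is
    positive. *)
Lemma smooth_bump (x0 : 'rV[R]_m) (e : R) : 0 < e ->
  exists b : 'rV[R]_m -> R^o, [/\ forall x, smooth_at b x,
    \forall x \near x0, b x = 1 & forall x, e < `|x - x0| -> b x = 0].
Proof.
move=> e0; pose q (x : 'rV[R]_m) : R^o :=
  \sum_j (x 0 j - x0 0 j) * (x 0 j - x0 0 j).
have sq x : smooth_at q x.
  apply: smooth_at_sum => j _; apply: smooth_atM;
  by apply: smooth_atB; [exact/smooth_at_entry/smooth_at_id|exact: smooth_at_cst].
pose d := e ^+ 2; have d0 : 0 < d by rewrite exprn_gt0.
pose a x : R^o := expVp 1 (d - q x); pose b x : R^o := expVp 1 (q x - d / 2).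
have ab x : 0 < a x + b x.
  have [qd|qd] := ltP (q x) d.
    by rewrite ltr_pwDl ?expVp1_ge0 // expVp1_gt0 subr_gt0.
  rewrite ltr_pwDr ?expVp1_ge0 // expVp1_gt0 subr_gt0.
  by apply: lt_le_trans qd; rewrite ltr_pdivrMr // ltr_pMr // ltr1n.
have sa x : smooth_at a x.
  by apply: smooth_at_expVp; apply: smooth_atB => //; exact: smooth_at_cst.
have sb x : smooth_at b x.
  by apply: smooth_at_expVp; apply: smooth_atB => //; exact: smooth_at_cst.
exists (fun x => a x / (a x + b x)); split.
- move=> x; apply: smooth_atM => //.
  by apply: smooth_at_inv; [rewrite gt_eqF|exact: smooth_atD].
- have qx0 : q x0 = 0 by apply: big1 => j _; rewrite subrr mul0r.
  have : \forall x \near x0, q x < d / 2.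
    apply: (near_comp (P := fun t => t < d / 2) (smooth_at_continuous (sq x0))).
    by rewrite qx0; apply: lt_nbhsl; rewrite divr_gt0.
  apply: filterS => x qd; rewrite /b expVp_eq0 ?addr0; last by rewrite subr_le0 ltW.
  rewrite divff // gt_eqF // expVp1_gt0 subr_gt0 (lt_trans qd) //.
  by rewrite ltr_pdivrMr // ltr_pMr // ltr1n.
move=> x ex; rewrite /a expVp_eq0 ?mul0r // subr_le0.
(* The norm on row vectors is the maximum norm: exceeding [e] in norm means exceeding it in one
   coordinate, and then [q] exceeds [e^2]. *)
have [j ej] : exists j, e < `|x 0 j - x0 0 j|.
  apply/not_existsP => H; move: ex; rewrite ltNge => /negP; apply.
  rewrite /Num.norm /= mx_normrE (bigmax_le _ (ltW e0)) // => -[i j] _ /=.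
  by rewrite !mxE ord1 leNgt; apply/negP; exact: H.
rewrite /q (bigD1 j) //= ler_wpDr //.
  by apply: sumr_ge0 => i _; rewrite -expr2 sqr_ge0.
by rewrite -expr2 -real_normK ?num_real // /d lerXn2r ?nnegrE // ltW.
Qed.

End OneVariable.

(** * Calculus in charts *)

Section Charts.
Context {R : realType} {m : nat} {M : topologicalType} (A : atlas R m M).
Implicit Types (c d : chart R m M) (p q : M) (W : normedModType R).

Definition chart_injective c :=
  forall p q, cdom c p -> cdom c q -> cmap c p = cmap c q -> p = q.

(** Everything is expressed through images in ['rV[R]_m], not through open sets of [M], so that the
    calculus applies verbatim to the charts of the tangent bundle. *)
Record compatible c : Prop := Compatible {
  compatible_inj : chart_injective c;
  compatible_open_to : forall i, open (cmap c @` (cdom c `&` cdom (A i)));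
  compatible_open_from : forall i, open (cmap (A i) @` (cdom (A i) `&` cdom c));
  compatible_to : forall i, smooth_transition c (A i);
  compatible_from : forall i, smooth_transition (A i) c }.

Definition smooth_atlas : Prop :=
  (forall p, exists i, cdom (A i) p) /\ forall i, compatible (A i).

(** Neighbourhoods of [p] read in a chart; the existential also says that the image of the chart
    fills a neighbourhood of [cmap c p]. *)
Definition chart_near (P : M -> Prop) c p : Prop :=
  \forall y \near cmap c p, exists q, [/\ cdom c q, cmap c q = y & P q].

Lemma local_repE c W (F : M -> W) p :
  chart_injective c -> cdom c p -> local_rep c F (cmap c p) = F p.
Proof.
move=> ci cp; apply: xget_unique; first by exists p.
by move=> y [q [cq qp ->]]; congr F; exact: ci.
Qed.

Lemma chart_near_sub c p (P Q : M -> Prop) :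
  (forall q, cdom c q -> P q -> Q q) -> chart_near P c p -> chart_near Q c p.
Proof.
by move=> PQ; apply: filterS => y [q [cq qy Pq]]; exists q; split=> //; exact: PQ.
Qed.

Lemma chart_near_self c p (P : M -> Prop) : chart_injective c -> cdom c p ->
  chart_near P c p -> P p.
Proof.
move=> ci cp /nbhs_singleton [q [cq E Pq]].
by rewrite -(ci _ _ cq cp E).
Qed.

Lemma chart_near_eq c p (P : M -> Prop) T (f g : 'rV[R]_m -> T) :
  chart_near P c p -> (forall q, cdom c q -> P q -> f (cmap c q) = g (cmap c q)) ->
  \forall y \near cmap c p, f y = g y.
Proof. by move=> nP fg; apply: filterS nP => y [q [cq <- /(fg _ cq)]]. Qed.

Lemma open_chart_near c p (V : set M) : open (cmap c @` (cdom c `&` V)) ->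
  cdom c p -> V p -> chart_near V c p.
Proof.
move=> oV cp Vp.
have : \forall y \near cmap c p, (cmap c @` (cdom c `&` V)) y.
  by apply: open_nbhs_nbhs; split => //; exists p.
by apply: filterS => y [q [cq Vq] <-]; exists q.
Qed.

Hypothesis hA : smooth_atlas.

Let cover p : exists i, cdom (A i) p. Proof. by have [] := hA. Qed.

Lemma atlas_compatible i : compatible (A i). Proof. by have [] := hA. Qed.

Let Ai i : chart_injective (A i).
Proof. exact/compatible_inj/atlas_compatible. Qed.

Let to_at c i p : compatible c -> cdom c p -> cdom (A i) p ->
  smooth_at (local_rep c (cmap (A i))) (cmap c p).
Proof.
move=> cc cp ip; apply: smooth_on_at (compatible_to cc i) _.
  exact: compatible_open_to.
by exists p.
Qed.

Let from_at c i p : compatible c -> cdom c p -> cdom (A i) p ->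
  smooth_at (local_rep (A i) (cmap c)) (cmap (A i) p).
Proof.
move=> cc cp ip; apply: smooth_on_at (compatible_from cc i) _.
  exact: compatible_open_from.
by exists p.
Qed.

(** Compatibility relates a chart to those of the atlas only, so [c] and [d] are compared through
    some [A i] around [p]. *)
Lemma chart_near_dom c d p : compatible c -> compatible d ->
  cdom c p -> cdom d p -> chart_near (cdom d) c p.
Proof.
move=> cc cd cp dp; have [i ip] := cover p.
have ni : chart_near (cdom (A i)) c p.
  by apply: open_chart_near => //; exact: compatible_open_to.
have nd : chart_near (cdom d) (A i) p.
  by apply: open_chart_near => //; exact: compatible_open_from.
have ct := smooth_at_continuous (to_at cc cp ip).
have := near_comp ct; rewrite local_repE; [|exact: compatible_inj|by []].
move=> /(_ _ nd); apply: filterS2 ni => y [q [cq <- iq]] [q' [iq' E dq']].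
exists q; split=> //; move: E; rewrite local_repE //; last exact: compatible_inj.
by move=> /(Ai iq' iq) <-.
Qed.

Lemma smooth_at_transition c d p : compatible c -> compatible d ->
  cdom c p -> cdom d p -> smooth_at (local_rep c (cmap d)) (cmap c p).
Proof.
move=> cc cd cp dp; have [i ip] := cover p.
have ci := compatible_inj cc.
apply: (@smooth_at_near_eq _ _ _
  (fun y => local_rep (A i) (cmap d) (local_rep c (cmap (A i)) y))).
  apply: chart_near_eq (chart_near_dom cc (atlas_compatible i) cp ip) _.
  by move=> q cq iq; rewrite !local_repE //; exact: Ai.
apply: smooth_at_comp; first exact: to_at.
by rewrite local_repE //; exact: from_at.
Qed.

Lemma chart_near_change c d p (P : M -> Prop) : compatible c -> compatible d ->
  cdom c p -> cdom d p -> chart_near P c p -> chart_near P d p.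
Proof.
move=> cc cd cp dp nP.
have ci := compatible_inj cc; have di := compatible_inj cd.
have ct := smooth_at_continuous (smooth_at_transition cd cc dp cp).
have := near_comp ct; rewrite local_repE // => /(_ _ nP).
apply: filterS2 (chart_near_dom cd cc dp cp) => y [q [dq <- cq]] [q' [cq' E Pq']].
exists q; split => //; move: E; rewrite local_repE //.
by move=> /(ci _ _ cq' cq) <-.
Qed.

(** * Smooth maps on a manifold *)

Definition msmooth W (F : M -> W) p : Prop :=
  exists c, [/\ compatible c, cdom c p & smooth_at (local_rep c F) (cmap c p)].

Lemma msmooth_pullback c p W (F : M -> W) (f : 'rV[R]_m -> W) :
  compatible c -> cdom c p -> smooth_at f (cmap c p) ->
  chart_near (fun q => F q = f (cmap c q)) c p -> msmooth F p.
Proof.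
move=> cc cp sf nF; exists c; split=> //; apply: smooth_at_near_eq sf.
apply: chart_near_eq nF _ => q cq Fq.
by rewrite local_repE //; exact: compatible_inj.
Qed.

Lemma msmooth_chart c p W (F : M -> W) : compatible c -> cdom c p ->
  msmooth F p -> smooth_at (local_rep c F) (cmap c p).
Proof.
move=> cc cp [d [cd dp sF]].
have ci := compatible_inj cc; have di := compatible_inj cd.
apply: (@smooth_at_near_eq _ _ _
  (fun y => local_rep d F (local_rep c (cmap d) y))).
  apply: chart_near_eq (chart_near_dom cc cd cp dp) _.
  by move=> q cq iq; rewrite !local_repE.
apply: smooth_at_comp; first exact: smooth_at_transition.
by rewrite local_repE.
Qed.

Lemma msmooth_near_eq c p W (F G : M -> W) : compatible c -> cdom c p ->
  chart_near (fun q => F q = G q) c p -> msmooth F p -> msmooth G p.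
Proof.
move=> cc cp FG sF; apply: (msmooth_pullback cc cp (msmooth_chart cc cp sF)).
apply: chart_near_sub FG => q cq <-.
by rewrite local_repE //; exact: compatible_inj.
Qed.

Lemma msmooth_ext W (F G : M -> W) p : F =1 G -> msmooth F p -> msmooth G p.
Proof. by move=> /funext ->. Qed.

Lemma smooth_inP c W (F : M -> W) : compatible c ->
  smooth_in c F <-> forall p, cdom c p -> msmooth F p.
Proof.
move=> cc; split=> [sF p cp|sF].
  exists c; split=> //; apply: smooth_on_at sF _; last by exists p.
  rewrite openE => _ [q cq <-]; have [i iq] := cover q.
  have := chart_near_dom cc (atlas_compatible i) cq iq.
  by apply: filterS => y [q' [cq' <- _]]; exists q'.
by apply: smooth_at_on => _ [p cp <-]; apply: msmooth_chart => //; exact: sF.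
Qed.

Lemma smooth_funP (f : M -> R) :
  smooth_fun A f <-> forall p, msmooth (f : M -> R^o) p.
Proof.
split=> [sf p|sf i]; last by apply/(smooth_inP _ (atlas_compatible i)) => p _.
have [i ip] := cover p; have := sf i.
by move=> /(smooth_inP _ (atlas_compatible i)); exact.
Qed.

Lemma msmooth_cmap c p : compatible c -> cdom c p -> msmooth (cmap c) p.
Proof.
move=> cc cp; apply: (msmooth_pullback cc cp (smooth_at_id _)).
by apply: chart_near_sub (chart_near_dom cc cc cp cp).
Qed.

Lemma msmooth_chart_near c p W (F : M -> W) : compatible c -> cdom c p ->
  msmooth F p -> chart_near (msmooth F) c p.
Proof.
move=> cc cp sF; have := near_smooth_at (msmooth_chart cc cp sF).
apply: filterS2 (chart_near_dom cc cc cp cp) => y [q [cq <- _]] sq.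
by exists q; split=> //; exists c.
Qed.

Lemma msmooth_cst W (w : W) p : msmooth (fun=> w) p.
Proof.
have [i ip] := cover p.
apply: (msmooth_pullback (atlas_compatible i) ip (smooth_at_cst w _)).
have ci := atlas_compatible i.
by apply: chart_near_sub (chart_near_dom ci ci ip ip).
Qed.

Let msmooth2 W1 W2 W (F : M -> W1) (G : M -> W2) (op : W1 -> W2 -> W) p :
  (forall f g (x : 'rV[R]_m), smooth_at f x -> smooth_at g x ->
     smooth_at (fun y => op (f y) (g y)) x) ->
  msmooth F p -> msmooth G p -> msmooth (fun q => op (F q) (G q)) p.
Proof.
move=> H sF sG; have [i ip] := cover p; have ci := atlas_compatible i.
apply: (msmooth_pullback ci ip (H _ _ _ (msmooth_chart ci ip sF)
  (msmooth_chart ci ip sG))).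
apply: chart_near_sub (chart_near_dom ci ci ip ip) => q iq _.
by rewrite !local_repE //; exact: Ai.
Qed.

Lemma msmoothD W (F G : M -> W) p : msmooth F p -> msmooth G p ->
  msmooth (fun q => F q + G q) p.
Proof. by apply: msmooth2 => f g x; exact: smooth_atD. Qed.

Lemma msmoothB W (F G : M -> W) p : msmooth F p -> msmooth G p ->
  msmooth (fun q => F q - G q) p.
Proof.
by apply: (msmooth2 (op := fun a b => a - b)) => f g x; exact: smooth_atB.
Qed.

Lemma msmooth_scale W (f : M -> R^o) (F : M -> W) p : msmooth f p ->
  msmooth F p -> msmooth (fun q => f q *: F q) p.
Proof. by apply: msmooth2 => g h x; exact: smooth_at_scale. Qed.

Lemma msmooth_row_mx a b (F : M -> 'rV[R]_a) (G : M -> 'rV[R]_b) p :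
  msmooth F p -> msmooth G p -> msmooth (fun q => row_mx (F q) (G q)) p.
Proof. by apply: msmooth2 => f g x; exact: smooth_at_row_mx. Qed.

Lemma msmooth_sum W (I : Type) (r : seq I) (P : pred I) (F : I -> M -> W) p :
  (forall i, P i -> msmooth (F i) p) ->
  msmooth (fun q => \sum_(i <- r | P i) F i q) p.
Proof.
move=> sF; elim: r => [|i r IH].
  by apply: msmooth_ext (msmooth_cst (0 : W) p) => q; rewrite big_nil.
case Pi: (P i); last by apply: msmooth_ext IH => q; rewrite big_cons Pi.
by apply: msmooth_ext (msmoothD (sF i Pi) IH) => q; rewrite big_cons Pi.
Qed.

Lemma msmooth_comp n W (F : M -> 'rV[R]_n) (f : 'rV[R]_n -> W) p :
  msmooth F p -> smooth_at f (F p) -> msmooth (fun q => f (F q)) p.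
Proof.
move=> sF sf; have [i ip] := cover p; have ci := atlas_compatible i.
have sf' : smooth_at f (local_rep (A i) F (cmap (A i) p)) by rewrite local_repE.
apply: (msmooth_pullback ci ip (smooth_at_comp (msmooth_chart ci ip sF) sf')).
apply: chart_near_sub (chart_near_dom ci ci ip ip) => q iq _.
by rewrite !local_repE //; exact: Ai.
Qed.

Lemma msmooth_derive n W (F G : M -> 'rV[R]_n) (f : 'rV[R]_n -> W) p :
  msmooth F p -> msmooth G p -> smooth_at f (F p) ->
  msmooth (fun q => 'D_(G q) f (F q)) p.
Proof.
move=> sF sG sf; have [i ip] := cover p; have ci := atlas_compatible i.
have sf' : smooth_at f (local_rep (A i) F (cmap (A i) p)) by rewrite local_repE.
apply: (msmooth_pullback ci ip (smooth_at_derive_along sf' (msmooth_chart ci ip sF)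
  (msmooth_chart ci ip sG))).
apply: chart_near_sub (chart_near_dom ci ci ip ip) => q iq _.
by rewrite !local_repE //; exact: Ai.
Qed.

Lemma msmooth_mulmxr a b (F : M -> 'rV[R]_a) (K : 'M[R]_(a, b)) p :
  msmooth F p -> msmooth (fun q => F q *m K) p.
Proof.
move=> sF; apply: (msmooth_comp (f := fun x => x *m K) sF).
exact/smooth_at_mulmxr/smooth_at_id.
Qed.

(* Tangent vectors, their components and derivations *)
Local Opaque local_rep diff derive.

Lemma derive_local_rep_change c d p W (F : M -> W) w : compatible c ->
  compatible d -> cdom c p -> cdom d p -> msmooth F p ->
  'D_w (local_rep c F) (cmap c p) =
  'D_('D_w (local_rep c (cmap d)) (cmap c p)) (local_rep d F) (cmap d p).
Proof.
move=> cc cd cp dp sF.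
have ci := compatible_inj cc; have di := compatible_inj cd.
have s1 := smooth_at_differentiable (smooth_at_transition cc cd cp dp).
have s2 : differentiable (local_rep d F) (local_rep c (cmap d) (cmap c p)).
  by rewrite local_repE //; exact: smooth_at_differentiable (msmooth_chart cd dp sF).
have := derive_compE w s1 s2; rewrite (local_repE _ ci cp) => <-.
apply: near_eq_derive.
apply: chart_near_eq (chart_near_dom cc cd cp dp) _ => q cq dq.
by rewrite !local_repE.
Qed.

Lemma derive_local_rep_self c p w : compatible c -> cdom c p ->
  'D_w (local_rep c (cmap c)) (cmap c p) = w.
Proof.
move=> cc cp; rewrite -[RHS](derive_id (cmap c p) w); apply: near_eq_derive.
apply: chart_near_eq (chart_near_dom cc cc cp cp) _ => q cq _.
by rewrite local_repE //; exact: compatible_inj.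
Qed.

Lemma tangent_change i j p (v : tangent A p) : cdom (A i) p -> cdom (A j) p ->
  v j = 'D_(v i) (local_rep (A i) (cmap (A j))) (cmap (A i) p).
Proof.
move=> ip jp; have /asboolP[_ vE] := coordsP v; rewrite (vE i j ip jp) deriveE //.
apply/smooth_at_differentiable/smooth_at_transition => //;
exact: atlas_compatible.
Qed.

Lemma tangent_ext p (u v : tangent A p) :
  (forall i, cdom (A i) p -> u i = v i) -> u = v.
Proof.
move=> uv; apply: val_inj; apply/funext => i /=.
have [ip|ip] := pselect (cdom (A i) p); first exact: uv.
have /asboolP[u0 _] := coordsP u; have /asboolP[v0 _] := coordsP v.
by rewrite u0 // v0.
Qed.

(** By the chain rule all charts of the atlas around [p] give the same value, so the choice made by
    [xget] is harmless. *)
Lemma tderiv_atlas i p (v : tangent A p) W (F : M -> W) :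
  cdom (A i) p -> msmooth F p ->
  tderiv v F = 'D_(v i) (local_rep (A i) F) (cmap (A i) p).
Proof.
move=> ip sF; have ca j := atlas_compatible j.
have dE j (jp : cdom (A j) p) :
    'd (local_rep (A j) F) (cmap (A j) p) (v j) =
    'D_(v j) (local_rep (A j) F) (cmap (A j) p).
  by rewrite deriveE //; exact: smooth_at_differentiable (msmooth_chart (ca j)
    jp sF).
apply: xget_unique; first by exists i; rewrite ?dE.
move=> y [j jp ->]; rewrite dE // (tangent_change v ip jp).
exact/esym/derive_local_rep_change.
Qed.

(** Coordinates adapted to [J] need not belong to the atlas, so components are defined for arbitrary
    charts, as the derivative of the coordinate map along [v]. *)
Definition tcoord c p (v : tangent A p) : 'rV[R]_m := tderiv v (cmap c).

Lemma tcoord_atlas i p (v : tangent A p) : cdom (A i) p -> tcoord (A i) v = v i.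
Proof.
move=> ip; have ci := atlas_compatible i.
by rewrite /tcoord (tderiv_atlas _ ip) ?derive_local_rep_self //;
  exact: msmooth_cmap.
Qed.

Lemma tderivE c p (v : tangent A p) W (F : M -> W) : compatible c -> cdom c p ->
  msmooth F p -> tderiv v F = 'D_(tcoord c v) (local_rep c F) (cmap c p).
Proof.
move=> cc cp sF; have [i ip] := cover p; have ci := atlas_compatible i.
have sc := msmooth_cmap cc cp.
by rewrite /tcoord !(tderiv_atlas _ ip) // -derive_local_rep_change.
Qed.

Lemma tcoord_change c d p (v : tangent A p) : compatible c -> compatible d ->
  cdom c p -> cdom d p ->
  tcoord d v = 'D_(tcoord c v) (local_rep c (cmap d)) (cmap c p).
Proof. by move=> cc cd cp dp; rewrite -tderivE //; exact: msmooth_cmap. Qed.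

Lemma tcoord_inj c p (u v : tangent A p) : compatible c -> cdom c p ->
  tcoord c u = tcoord c v -> u = v.
Proof.
move=> cc cp uv; apply: tangent_ext => i ip; have ci := atlas_compatible i.
rewrite -(tcoord_atlas u ip) -(tcoord_atlas v ip) (tcoord_change u cc ci cp ip) uv.
exact/esym/tcoord_change.
Qed.

Lemma exists_tcoord c p w : compatible c -> cdom c p ->
  exists v : tangent A p, tcoord c v = w.
Proof.
move=> cc cp.
(* [w] is pushed to each chart of the atlas by the differential of the coordinate change from [c];
   the coherence of the family is the chain rule. *)
pose v (i : ix A) : 'rV[R]_m := if pselect (cdom (A i) p) then
  'D_w (local_rep c (cmap (A i))) (cmap c p) else 0.
have vE i : cdom (A i) p ->
    v i = 'D_w (local_rep c (cmap (A i))) (cmap c p).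
  by rewrite /v; case: pselect.
have vP : v \in tangent_pred (A := A) p.
  apply/asboolP; split=> [i ip|i j ip jp]; first by rewrite /v; case: pselect.
  have ci := atlas_compatible i; have cj := atlas_compatible j.
  rewrite !vE // -deriveE; last first.
    exact/smooth_at_differentiable/smooth_at_transition.
  by rewrite -derive_local_rep_change //; exact: msmooth_cmap.
exists (Tangent vP); have [i ip] := cover p; have ci := atlas_compatible i.
rewrite (tcoord_change _ ci cc ip cp) tcoord_atlas //= vE //.
by rewrite -derive_local_rep_change ?derive_local_rep_self //; exact: msmooth_cmap.
Qed.

Definition mkvec c p (w : 'rV[R]_m) : tangent A p :=
  xget 0 [set v | tcoord c v = w].

Lemma mkvecK c p w : compatible c -> cdom c p -> tcoord c (mkvec c p w) = w.
Proof.
move=> cc cp; have [v vw] := exists_tcoord w cc cp.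
exact: (xgetI 0 (P := [set v : tangent A p | tcoord c v = w]) vw).
Qed.

Lemma tcoordK c p (v : tangent A p) : compatible c -> cdom c p ->
  mkvec c p (tcoord c v) = v.
Proof. by move=> cc cp; apply: (tcoord_inj cc cp); exact: mkvecK. Qed.

Lemma tderiv_linear p a (u v : tangent A p) W (F : M -> W) : msmooth F p ->
  tderiv (a *: u + v) F = a *: tderiv u F + tderiv v F.
Proof.
move=> sF; have [i ip] := cover p.
rewrite !(tderiv_atlas _ ip) // -derive_linear //.
exact: smooth_at_differentiable (msmooth_chart (atlas_compatible i) ip sF).
Qed.

Lemma tcoord_linear c p a (u v : tangent A p) : compatible c -> cdom c p ->
  tcoord c (a *: u + v) = a *: tcoord c u + tcoord c v.
Proof. by move=> cc cp; apply: tderiv_linear; exact: msmooth_cmap. Qed.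

Lemma tcoordD c p (u v : tangent A p) : compatible c -> cdom c p ->
  tcoord c (u + v) = tcoord c u + tcoord c v.
Proof. by move=> cc cp; rewrite -[u]scale1r tcoord_linear // !scale1r. Qed.

Lemma tcoordZ c p a (u : tangent A p) : compatible c -> cdom c p ->
  tcoord c (a *: u) = a *: tcoord c u.
Proof.
move=> cc cp; have := tcoord_linear a u 0 cc cp; rewrite addr0 => ->.
suff -> : tcoord c (0 : tangent A p) = 0 by rewrite addr0.
by have := tcoord_linear (-1) 0 0 cc cp; rewrite scaler0 addr0 scaleN1r addNr.
Qed.

Lemma tcoord0 c p : compatible c -> cdom c p -> tcoord c (0 : tangent A p) = 0.
Proof. by move=> cc cp; rewrite -[X in tcoord c X](scale0r 0)
  tcoordZ // scale0r. Qed.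

Lemma tcoordB c p (u v : tangent A p) : compatible c -> cdom c p ->
  tcoord c (u - v) = tcoord c u - tcoord c v.
Proof. by move=> cc cp; rewrite -scaleN1r tcoordD // tcoordZ // scaleN1r. Qed.

Lemma tcoord_sum c p (I : Type) (r : seq I) (v : I -> tangent A p) :
  compatible c -> cdom c p ->
  tcoord c (\sum_(i <- r) v i) = \sum_(i <- r) tcoord c (v i).
Proof.
move=> cc cp; elim: r => [|i r IH]; first by rewrite !big_nil tcoord0.
by rewrite !big_cons tcoordD // IH.
Qed.

Lemma tderiv_near_eq c p (v : tangent A p) W (F G : M -> W) : compatible c ->
  cdom c p -> chart_near (fun q => F q = G q) c p -> msmooth F p ->
  tderiv v F = tderiv v G.
Proof.
move=> cc cp FG sF; have sG := msmooth_near_eq cc cp FG sF.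
rewrite !(tderivE _ cc cp) //; apply: near_eq_derive.
apply: chart_near_eq FG _ => q cq FGq.
by rewrite !local_repE //; exact: compatible_inj.
Qed.

Lemma tderivD p (v : tangent A p) W (F G : M -> W) : msmooth F p ->
  msmooth G p -> tderiv v (fun q => F q + G q) = tderiv v F + tderiv v G.
Proof.
move=> sF sG; have [i ip] := cover p; have ci := atlas_compatible i.
rewrite !(tderiv_atlas _ ip) //; last exact: msmoothD.
have dF := smooth_at_differentiable (msmooth_chart ci ip sF).
have dG := smooth_at_differentiable (msmooth_chart ci ip sG).
rewrite -deriveD; [|exact: diff_derivable|exact: diff_derivable].
apply: near_eq_derive.
apply: chart_near_eq (chart_near_dom ci ci ip ip) _ => q iq _.
by rewrite [RHS]/(_ + _) !local_repE.
Qed.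

Lemma tderiv_scale p (v : tangent A p) W (f : M -> R^o) (F : M -> W) :
  msmooth f p -> msmooth F p ->
  tderiv v (fun q => f q *: F q) = f p *: tderiv v F + tderiv v f *: F p.
Proof.
move=> sf sF; have [i ip] := cover p; have ci := atlas_compatible i.
rewrite !(tderiv_atlas _ ip) //; last exact: msmooth_scale.
have df := smooth_at_differentiable (msmooth_chart ci ip sf).
have dF := smooth_at_differentiable (msmooth_chart ci ip sF).
have := derive_scale (v i) df dF; rewrite !local_repE // => <-.
apply: near_eq_derive.
apply: chart_near_eq (chart_near_dom ci ci ip ip) _ => q iq _.
by rewrite !local_repE.
Qed.

Lemma tderiv_comp p (v : tangent A p) n W (F : M -> 'rV[R]_n)
    (f : 'rV[R]_n -> W) : msmooth F p -> smooth_at f (F p) ->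
  tderiv v (fun q => f (F q)) = 'D_(tderiv v F) f (F p).
Proof.
move=> sF sf; have [i ip] := cover p; have ci := atlas_compatible i.
rewrite !(tderiv_atlas _ ip) //; last exact: msmooth_comp.
have dF := smooth_at_differentiable (msmooth_chart ci ip sF).
have df := smooth_at_differentiable sf.
have df' : differentiable f (local_rep (A i) F (cmap (A i) p)).
  by rewrite local_repE.
have := derive_compE (v i) dF df'; rewrite (local_repE _ (@Ai i) ip) => <-.
apply: near_eq_derive.
apply: chart_near_eq (chart_near_dom ci ci ip ip) _ => q iq _.
by rewrite !local_repE.
Qed.

(** * Smooth vector fields and their brackets *)

Definition vsmooth (X : vfield A) p : Prop :=
  exists c, [/\ compatible c, cdom c p & msmooth (fun q => tcoord c (X q)) p].

Lemma vsmooth_chart c p (X : vfield A) : compatible c -> cdom c p ->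
  vsmooth X p -> msmooth (fun q => tcoord c (X q)) p.
Proof.
move=> cc cp [d [cd dp sX]].
have st := smooth_at_transition cd cc dp cp.
apply: (msmooth_near_eq cd dp) (msmooth_derive (msmooth_cmap cd dp) sX st).
apply: chart_near_sub (chart_near_dom cd cc dp cp) => q dq cq.
by rewrite -tcoord_change.
Qed.

Lemma smooth_vfieldP (X : vfield A) : smooth_vfield X <-> forall p, vsmooth X p.
Proof.
split=> [sX p|sX i].
  have [i ip] := cover p; have ci := atlas_compatible i.
  exists (A i); split=> //; have /(smooth_inP _ ci)/(_ _ ip) := sX i.
  apply: (msmooth_near_eq ci ip).
  by apply: chart_near_sub (chart_near_dom ci ci ip ip) => q iq _;
    rewrite tcoord_atlas.
have ci := atlas_compatible i; apply/(smooth_inP _ ci) => p ip.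
apply: (msmooth_near_eq ci ip) (vsmooth_chart ci ip (sX p)).
by apply: chart_near_sub (chart_near_dom ci ci ip ip) => q iq _;
  rewrite tcoord_atlas.
Qed.

Lemma msmooth_tderiv p (X : vfield A) W (F : M -> W) : vsmooth X p ->
  msmooth F p -> msmooth (fun q => tderiv (X q) F) p.
Proof.
move=> sX sF; have [i ip] := cover p; have ci := atlas_compatible i.
apply: (msmooth_near_eq ci ip) (msmooth_derive (msmooth_cmap ci ip)
  (vsmooth_chart ci ip sX) (msmooth_chart ci ip sF)).
apply: chart_near_sub (msmooth_chart_near ci ip sF) => q iq sFq.
by rewrite -tderivE.
Qed.

Let addrKA' (V : zmodType) (a a' b c : V) :
  a = a' -> - c + b = a + b - (a' + c).
Proof. by move=> <-; rewrite opprD addrACA subrr add0r addrC. Qed.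

(** In the chart [c] an iterated derivative of [f] splits into a second derivative of [f] and a
    derivative of [f] along differentiated components; in the commutator the second derivatives
    cancel by symmetry. *)
Lemma tderiv_bracket c p (X Y : vfield A) (f : M -> R^o) :
  compatible c -> cdom c p -> vsmooth X p -> vsmooth Y p -> msmooth f p ->
  tderiv (mkvec c p (tderiv (X p) (fun q => tcoord c (Y q)) -
                     tderiv (Y p) (fun q => tcoord c (X q)))) f =
  tderiv (X p) (fun q => tderiv (Y q) f) - tderiv (Y p) (fun q => tderiv (X q) f).
Proof.
move=> cc cp sX sY sf; have ci := compatible_inj cc.
have sfc := msmooth_chart cc cp sf.
have E (U V : vfield A) : vsmooth U p -> vsmooth V p ->
  tderiv (U p) (fun q => tderiv (V q) f) =
  'D_(tcoord c (U p)) ('D_(tcoord c (V p)) (local_rep c f)) (cmap c p) +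
  'D_(tderiv (U p) (fun q => tcoord c (V q))) (local_rep c f) (cmap c p).
  move=> sU sV; have sVc := vsmooth_chart cc cp sV.
  have sVl := msmooth_chart cc cp sVc.
  rewrite (tderivE _ cc cp (msmooth_tderiv sV sf)) (tderivE _ cc cp sVc).
  have := derive_along (tcoord c (U p)) sfc (smooth_at_id _) sVl.
  rewrite derive_id (local_repE _ ci cp) => <-; apply: near_eq_derive.
  apply: chart_near_eq (msmooth_chart_near cc cp sf) _ => q cq sfq.
  by rewrite !local_repE // -tderivE.
rewrite (tderivE _ cc cp) // mkvecK // E // E //.
have dfc := smooth_at_differentiable sfc.
rewrite -scaleN1r addrC derive_linear // scaleN1r.
exact: (addrKA' _ _ (derive_comm_real _ _ sfc)).
Qed.

Lemma tderiv0 p W (F : M -> W) : msmooth F p -> tderiv (0 : tangent A p) F = 0.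
Proof.
move=> sF; have := tderiv_linear (-1) 0 0 sF.
by rewrite scaler0 addr0 scaleN1r addNr.
Qed.

Lemma tderiv_mulmxr p (v : tangent A p) a b (F : M -> 'rV[R]_a)
    (K : 'M[R]_(a, b)) : msmooth F p ->
  tderiv v (fun q => F q *m K) = tderiv v F *m K.
Proof.
move=> sF; have sK : smooth_at (mulmxr K : 'rV_a -> 'rV_b) (F p).
  exact/smooth_at_mulmxr/smooth_at_id.
rewrite (tderiv_comp v sF sK) deriveE; last exact: smooth_at_differentiable.
by rewrite diff_lin //; exact: mx_linear_continuous.
Qed.

Lemma tderiv_pullback c p (v : tangent A p) W (F : M -> W) (f : 'rV[R]_m -> W) :
  compatible c -> cdom c p -> smooth_at f (cmap c p) ->
  chart_near (fun q => F q = f (cmap c q)) c p ->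
  tderiv v F = 'D_(tcoord c v) f (cmap c p).
Proof.
move=> cc cp sf Ff; rewrite (tderivE v cc cp (msmooth_pullback cc cp sf Ff)).
apply: near_eq_derive; apply: chart_near_eq Ff _ => q cq <-.
exact: local_repE (compatible_inj cc) cq.
Qed.

Lemma msmooth_mkvec c d p (u : M -> 'rV[R]_m) : compatible c -> compatible d ->
  cdom c p -> cdom d p -> msmooth u p ->
  msmooth (fun q => tcoord d (mkvec c q (u q))) p.
Proof.
move=> cc cd cp dp su.
apply: (msmooth_near_eq cc cp) (msmooth_derive (msmooth_cmap cc cp) su
  (smooth_at_transition cc cd cp dp)).
apply: chart_near_sub (chart_near_dom cc cd cp dp) => q cq dq.
by rewrite (tcoord_change _ cc cd cq dq) mkvecK.
Qed.

Lemma mkvec_linear c p a (u v : 'rV[R]_m) : compatible c -> cdom c p ->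
  mkvec c p (a *: u + v) = a *: mkvec c p u + mkvec c p v.
Proof.
move=> cc cp; apply: (tcoord_inj cc cp); rewrite (mkvecK _ cc cp).
apply: etrans _ (esym (tcoord_linear a (mkvec c p u) (mkvec c p v) cc cp)).
by rewrite !(mkvecK _ cc cp).
Qed.

(** * Endomorphism fields with constant components and flat connections *)

Definition constant_in (J : endo_field A) c (K : 'M[R]_m) : Prop :=
  forall q v, cdom c q -> tcoord c (J q v) = tcoord c v *m K.

Lemma vsmooth_endo_app (J : endo_field A) (X : vfield A) c K p : compatible c ->
  cdom c p -> constant_in J c K -> vsmooth X p -> vsmooth (endo_app J X) p.
Proof.
move=> cc cp JK sX; exists c; split=> //.
apply: (msmooth_near_eq cc cp) (msmooth_mulmxr K (vsmooth_chart cc cp sX)).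
by apply: chart_near_sub (chart_near_dom cc cc cp cp) => q cq _; rewrite JK.
Qed.

(** In a chart of the atlas, row [j] of the matrix of [J] arises by moving the basis vector [j] to
    an adapted chart, applying the constant [K] and moving back; each of these operations is
    smooth. *)
Lemma smooth_endo_field_constant (J : endo_field A) :
  (forall p, exists c K, [/\ compatible c, cdom c p & constant_in J c K]) ->
  smooth_endo_field J.
Proof.
move=> hJ; pose L i p (u : 'rV[R]_m) := tcoord (A i) (J p (mkvec (A i) p u)).
exists (fun i p => \matrix_(j, k) L i p (delta_mx 0 j) 0 k) => i.
have ci := atlas_compatible i; split.
  apply/(smooth_inP _ ci) => p ip; have [c [K [cc cp JK]]] := hJ p.
  have sL j : msmooth (fun q => L i q (delta_mx 0 j)) p.
    have s1 := msmooth_mkvec ci cc ip cp (msmooth_cst (delta_mx 0 j : 'rV[R]_m) p).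
    apply: (msmooth_near_eq cc cp) (msmooth_mkvec cc ci cp ip (msmooth_mulmxr K s1)).
    apply: chart_near_sub (chart_near_dom cc ci cp ip) => q cq iq.
    by congr (tcoord _ _); apply: (tcoord_inj cc cq); rewrite mkvecK // JK.
  exists (A i); split=> //; apply: smooth_at_mx => j k.
  apply: (@smooth_at_near_eq _ _ R^o (fun y => local_rep (A i)
    (fun q => L i q (delta_mx 0 j)) y 0 k)).
    apply: chart_near_eq (chart_near_dom ci ci ip ip) _ => q iq _.
    by rewrite !local_repE // mxE.
  exact/smooth_at_entry/msmooth_chart.
move=> p v ip; rewrite -(tcoord_atlas v ip) -(tcoord_atlas (J p v) ip).
rewrite -(linear_mulmxE (L := L i p)); first by rewrite /L tcoordK.
move=> t u w; rewrite /L mkvec_linear // linearP.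
exact: tcoord_linear.
Qed.

(* Christoffel symbols 0 in the chart [c], hence parallel for every tensor field
   with constant components there. *)
Definition flat c (X Y : vfield A) : vfield A :=
  fun p => mkvec c p (tderiv (X p) (fun q => tcoord c (Y q))).

Section Flat.
Variables (c : chart R m M) (p : M).
Hypotheses (cc : compatible c) (cp : cdom c p).

Let sc (Y : vfield A) (sY : vsmooth Y p) := vsmooth_chart cc cp sY.

Let tcoord_flat X Y :
  tcoord c (flat c X Y p) = tderiv (X p) (fun q => tcoord c (Y q)).
Proof. exact: mkvecK. Qed.

Lemma flatDl (X X' Y : vfield A) : vsmooth Y p ->
  flat c (fun q => X q + X' q) Y p = flat c X Y p + flat c X' Y p.
Proof.
move=> sY; apply: (tcoord_inj cc cp).
rewrite (tcoordD (flat c X Y p) _ cc cp) !tcoord_flat -[X p]scale1r.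
by rewrite (tderiv_linear _ _ _ (sc sY)) !scale1r.
Qed.

(** The first argument enters through its value at [p] only, so [a] may be the value at [p] of a
    function. *)
Lemma flatZl (a : R) (X X' Y : vfield A) : vsmooth Y p -> X' p = a *: X p ->
  flat c X' Y p = a *: flat c X Y p.
Proof.
move=> sY XE; apply: (tcoord_inj cc cp).
rewrite (tcoordZ a (flat c X Y p) cc cp) !tcoord_flat XE.
have := tderiv_linear a (X p) 0 (sc sY); rewrite addr0 => ->.
by rewrite (tderiv0 (sc sY)) addr0.
Qed.

Lemma flatDr (X Y Y' : vfield A) : vsmooth Y p -> vsmooth Y' p ->
  flat c X (fun q => Y q + Y' q) p = flat c X Y p + flat c X Y' p.
Proof.
move=> sY sY'; apply: (tcoord_inj cc cp).
apply: etrans (tcoord_flat _ _) _; apply: etrans _ (esym (tcoordD _ _ cc cp)).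
apply: etrans _ (congr2 +%R (esym (tcoord_flat _ _)) (esym (tcoord_flat _ _))).
apply: etrans _ (tderivD _ (sc sY) (sc sY')).
apply/esym/(tderiv_near_eq _ cc cp).
  apply: chart_near_sub (chart_near_dom cc cc cp cp) => q cq _.
  by rewrite tcoordD.
exact: msmoothD (sc sY) (sc sY').
Qed.

Lemma flatZr f (X Y : vfield A) : msmooth (f : M -> R^o) p -> vsmooth Y p ->
  flat c X (fun q => f q *: Y q) p = f p *: flat c X Y p + vderiv X f p *: Y p.
Proof.
move=> sf sY; apply: (tcoord_inj cc cp).
apply: etrans (tcoord_flat _ _) _; apply: etrans _ (esym (tcoordD _ _ cc cp)).
apply: etrans _ (congr2 +%R (esym (tcoordZ _ _ cc cp)) (esym (tcoordZ _ _ cc cp))).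
apply: etrans _ (congr2 +%R (congr1 (fun v => f p *: v) (esym (tcoord_flat _ _)))
  (erefl _)).
apply: etrans _ (tderiv_scale _ sf (sc sY)).
apply/esym/(tderiv_near_eq _ cc cp).
  apply: chart_near_sub (chart_near_dom cc cc cp cp) => q cq _.
  by rewrite tcoordZ.
exact: msmooth_scale sf (sc sY).
Qed.

Lemma flat_parallel (J : endo_field A) (K : 'M[R]_m) (X Y : vfield A) :
  constant_in J c K ->
  vsmooth Y p -> flat c X (endo_app J Y) p = J p (flat c X Y p).
Proof.
move=> JK sY; apply: (tcoord_inj cc cp).
apply: etrans (tcoord_flat _ _) _.
apply: etrans _ (esym (JK p (flat c X Y p) cp)).
apply: etrans _ (congr1 (mulmxr K) (esym (tcoord_flat _ _))).
apply: etrans _ (tderiv_mulmxr _ _ (sc sY)).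
apply/esym/(tderiv_near_eq _ cc cp).
  apply: chart_near_sub (chart_near_dom cc cc cp cp) => q cq _.
  by rewrite JK.
exact: msmooth_mulmxr (sc sY).
Qed.

(** Vanishing torsion in terms of the action on functions, a form that passes to sums with
    coefficients of total 1. *)
Lemma flat_bracket (X Y : vfield A) (f : M -> R^o) :
  vsmooth X p -> vsmooth Y p -> msmooth f p ->
  tderiv (flat c X Y p - flat c Y X p) f =
  vderiv X (vderiv Y f) p - vderiv Y (vderiv X f) p.
Proof.
move=> sX sY sf; apply: etrans (tderiv_bracket cc cp sX sY sf).
congr (fun v => tderiv v f); apply: (tcoord_inj cc cp).
rewrite (tcoordB (flat c X Y p) _ cc cp) !tcoord_flat.
by rewrite mkvecK.
Qed.

Lemma msmooth_flat d (X Y : vfield A) : compatible d -> cdom d p ->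
  vsmooth X p -> vsmooth Y p -> msmooth (fun q => tcoord d (flat c X Y q)) p.
Proof.
move=> cd dp sX sY; apply: msmooth_mkvec => //.
exact: msmooth_tderiv sX (sc sY).
Qed.

End Flat.

(** * Gluing flat connections *)

(** The support condition in the form in which it is used: vanishing around every point off the
    domain, read in an arbitrary compatible chart. *)
Definition supported_in (c : chart R m M) (f : M -> R^o) : Prop :=
  forall d q, compatible d -> cdom d q -> ~ cdom c q ->
    chart_near (fun q' => f q' = 0) d q.

(** As the family is a sequence, local finiteness says that near each point all terms from some
    index on vanish. *)
Definition smooth_partition (c : nat -> chart R m M) (f : nat -> M -> R^o) : Prop :=
  [/\ forall k, compatible (c k), forall k q, msmooth (f k) q,
      forall k, supported_in (c k) (f k) &
      forall p, exists N, forall d, compatible d -> cdom d p ->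
        chart_near (fun q => (forall k, (N <= k)%N -> f k q = 0) /\
                             \sum_(0 <= k < N) f k q = 1) d p].

Section Gluing.
Variables (c : nat -> chart R m M) (f : nat -> M -> R^o).
Hypothesis hf : smooth_partition c f.

Let cc k : compatible (c k). Proof. by case: hf. Qed.

Let sf k q : msmooth (f k) q. Proof. by case: hf. Qed.

Let glue_exists p : exists N : nat, (forall k, (N <= k)%N -> f k p = 0) /\
  \sum_(0 <= k < N) f k p = 1.
Proof.
have [_ _ _ /(_ p)[N hN]] := hf; exists N.
have [i ip] := cover p; have ci := atlas_compatible i.
exact: (chart_near_self (@Ai i) ip (hN _ ci ip)).
Qed.

Let N p := projT1 (cid (glue_exists p)).

Let f0 p k : (N p <= k)%N -> f k p = 0.
Proof. by move: k; rewrite /N; case: cid => /= n []. Qed.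

Let f1 p : \sum_(0 <= k < N p) f k p = 1.
Proof. by rewrite /N; case: cid => /= n []. Qed.

Let dom_f p k : f k p != 0 -> cdom (c k) p.
Proof.
move=> fk0; apply/not_notP => ncp; have [_ _ /(_ k) sk _] := hf.
have [i ip] := cover p; have ci := atlas_compatible i.
have := chart_near_self (@Ai i) ip (sk _ _ ci ip ncp).
by move=> /eqP; rewrite (negbTE fk0).
Qed.

(** The truncation index [N p] is chosen point by point, with no regularity in [p]; near a given
    point the sum is rewritten with one fixed index. *)
Let sum_trunc (V : lmodType R) p (F : nat -> V) n n' :
  (forall k, (n <= k)%N -> f k p = 0) -> (forall k, (n' <= k)%N -> f k p = 0) ->
  \sum_(0 <= k < n) f k p *: F k = \sum_(0 <= k < n') f k p *: F k.
Proof.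
have main a b : (a <= b)%N -> (forall k, (a <= k)%N -> f k p = 0) ->
    \sum_(0 <= k < a) f k p *: F k = \sum_(0 <= k < b) f k p *: F k.
  move=> ab fa; rewrite (big_cat_nat (n := a) (p := b)) //=.
  rewrite [X in _ = _ + X]big_nat [X in _ = _ + X]big1 ?addr0 //.
  by move=> k /andP[ak _]; rewrite fa // scale0r.
move=> h h'; case: (leqP n n') => [/main|/ltnW/main]; first exact.
by move=> H; apply/esym/H.
Qed.

Definition glue (X Y : vfield A) : vfield A :=
  fun p => \sum_(0 <= k < N p) f k p *: flat (c k) X Y p.

(** Off the domain of [c k] the value of [flat (c k)] is meaningless, but it is multiplied by 0
    there. *)
Let eq_glue p (F G : nat -> tangent A p) :
  (forall k, cdom (c k) p -> F k = G k) ->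
  \sum_(0 <= k < N p) f k p *: F k = \sum_(0 <= k < N p) f k p *: G k.
Proof.
move=> FG; apply: eq_bigr => k _; have [->|/dom_f/FG -> //] := eqVneq (f k p) 0.
by rewrite !scale0r.
Qed.

Lemma vsmooth_glue X Y p : vsmooth X p -> vsmooth Y p -> vsmooth (glue X Y) p.
Proof.
move=> sX sY; have [i ip] := cover p; have ci := atlas_compatible i.
exists (A i); split=> //.
have [_ _ sup /(_ p)[n /(_ _ ci ip) hn]] := hf.
apply: (@msmooth_near_eq (A i) p _ (fun q => \sum_(0 <= k < n)
    f k q *: tcoord (A i) (flat (c k) X Y q))) => //.
  apply: chart_near_sub hn => q iq [fn _].
  rewrite tcoord_sum //; under [RHS]eq_bigr do rewrite tcoordZ //.
  by apply: sum_trunc fn _; exact: f0.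
apply: msmooth_sum => k _; have [ckp|nckp] := pselect (cdom (c k) p).
  by apply: msmooth_scale => //; exact: msmooth_flat.
apply: (msmooth_near_eq ci ip) (msmooth_cst 0 p).
by apply: chart_near_sub (sup k _ _ ci ip nckp) => q iq ->; rewrite scale0r.
Qed.

Lemma affine_connection_glue : affine_connection glue.
Proof.
split.
- move=> X Y /smooth_vfieldP sX /smooth_vfieldP sY; apply/smooth_vfieldP => p.
  exact: vsmooth_glue.
- move=> X X' Y _ _ /smooth_vfieldP sY p; rewrite /glue -big_split /=.
  under [RHS]eq_bigr do rewrite -scalerDr.
  by apply: eq_glue => k ckp; rewrite flatDl.
- move=> g X Y _ _ /smooth_vfieldP sY p; rewrite /glue scaler_sumr.
  under [RHS]eq_bigr do rewrite scalerA mulrC -scalerA.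
  by apply: eq_glue => k ckp; rewrite (@flatZl (c k) p _ _ (g p) X).
- move=> X Y Y' _ /smooth_vfieldP sY /smooth_vfieldP sY' p.
  rewrite /glue -big_split /=; under [RHS]eq_bigr do rewrite -scalerDr.
  by apply: eq_glue => k ckp; rewrite flatDr.
move=> g X Y /smooth_funP sg _ /smooth_vfieldP sY p; rewrite /glue scaler_sumr.
(* The derivative term of the Leibniz rule carries no coefficient: it is split up by writing 1 as
   the sum of the [f k p]. *)
rewrite -[vderiv X g p *: Y p]scale1r -{1}(f1 p) scaler_suml -big_split /=.
transitivity (\sum_(0 <= k < N p)
    f k p *: (g p *: flat (c k) X Y p + vderiv X g p *: Y p)).
  by apply: eq_glue => k ckp; exact: flatZr.
by apply: eq_bigr => k _; rewrite scalerDr !scalerA [g p * _]mulrC.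
Qed.

Lemma para_complex_glue (J : endo_field A) :
  (forall k, exists K : 'M[R]_m, constant_in J (c k) K) ->
  para_complex_connection J glue.
Proof.
move=> JK X Y _ /smooth_vfieldP sY p; apply/eqP; rewrite subr_eq0; apply/eqP.
rewrite /glue linear_sum; under [RHS]eq_bigr do rewrite linearZ.
apply: eq_glue => k ckp; have [K hK] := JK k.
by rewrite (flat_parallel _ _ _ hK).
Qed.

Lemma torsion_free_glue : torsion_free glue.
Proof.
move=> X Y /smooth_vfieldP sX /smooth_vfieldP sY.
(* The antisymmetrized connection is itself offered as the bracket; the content is that it acts on
   functions as the commutator. *)
exists (fun p => glue X Y p - glue Y X p); last by move=> p; rewrite subrr.
split.
  apply/smooth_vfieldP => p; have [i ip] := cover p; have ci := atlas_compatible i.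
  exists (A i); split=> //.
  apply: (msmooth_near_eq ci ip) (msmoothB
    (vsmooth_chart ci ip (vsmooth_glue (sX p) (sY p)))
    (vsmooth_chart ci ip (vsmooth_glue (sY p) (sX p)))).
  by apply: chart_near_sub (chart_near_dom ci ci ip ip) => q iq _; rewrite tcoordB.
move=> g /smooth_funP sg p; rewrite {1}/vderiv /glue -sumrB.
under eq_bigr do rewrite -scalerBr.
have [i ip] := cover p; have ci := atlas_compatible i.
have sgi := smooth_at_differentiable (msmooth_chart ci ip (sg p)).
have tsum n (F : nat -> tangent A p) : tderiv (\sum_(0 <= k < n) f k p *: F k) g =
    \sum_(0 <= k < n) f k p *: tderiv (F k) (g : M -> R^o).
  elim: n => [|n IH].
    by rewrite !big_geq // (tderiv0 (sg p)).
  rewrite !big_nat_recr //= -IH addrC [RHS]addrC.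
  exact: tderiv_linear (sg p).
rewrite tsum.
transitivity (\sum_(0 <= k < N p) f k p *:
    ((vderiv X (vderiv Y g) p - vderiv Y (vderiv X g) p) : R^o)).
  apply: eq_bigr => k _; have [->|/dom_f ckp] := eqVneq (f k p) 0.
    by rewrite !scale0r.
  by rewrite flat_bracket.
by rewrite -scaler_suml f1 scale1r.
Qed.

End Gluing.

End Charts.

(** * Partitions of unity *)

Section SmoothManifold.
Context {R : realType} {m : nat} {M : topologicalType} (A : atlas R m M).
Implicit Types (c d : chart R m M) (p q : M).

Lemma is_chart_open_image c d : is_chart c -> is_chart d ->
  open (cmap c @` (cdom c `&` cdom d)).
Proof.
move=> [oc _ _ co] [od _ _ _]; apply: co; first exact: openI.
by move=> q [].
Qed.

Lemma is_chart_injective c : is_chart c -> chart_injective c.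
Proof. by move=> [_ _ ci _] p q cp cq; apply: ci; exact/mem_set. Qed.

Hypothesis hM : smooth_manifold A.

Lemma atlas_is_chart i : is_chart (A i). Proof. by case: hM. Qed.

Lemma local_coordinates_compatible c : local_coordinates A c -> compatible A c.
Proof.
move=> [hc ct]; split=> [|i|i|i|i]; first exact: is_chart_injective.
- exact/is_chart_open_image/atlas_is_chart.
- by apply: is_chart_open_image => //; exact: atlas_is_chart.
- by have [] := ct i.
- by have [] := ct i.
Qed.

Lemma smooth_manifold_atlas : smooth_atlas A.
Proof.
split=> [|i]; first by case: hM.
apply: local_coordinates_compatible; split; first exact: atlas_is_chart.
by move=> j; case: hM => _ _ _ _ h; split; exact: h.
Qed.

Let hA := smooth_manifold_atlas.

Let cover p : exists i, cdom (A i) p. Proof. by have [] := hA. Qed.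

Lemma is_chart_near c p (P : M -> Prop) : is_chart c -> cdom c p ->
  (\forall q \near p, P q) -> chart_near P c p.
Proof.
move=> [oc _ _ co] cp nP.
have : nbhs p [set q | P q] by [].
rewrite nbhsE => -[V [oV Vp] VP].
have nV : chart_near (cdom c `&` V) c p.
  apply: open_chart_near => //; rewrite setIA setIid.
  by apply: co; [exact: openI|move=> q []].
by apply: chart_near_sub nV => q cq [_ /VP].
Qed.

(** The bridge from the topology of [M]: the neighbourhood is carried to a chart of the atlas, which
    is a homeomorphism, and from there to [d]. *)
Lemma near_chart_near d p (P : M -> Prop) : compatible A d -> cdom d p ->
  (\forall q \near p, P q) -> chart_near P d p.
Proof.
move=> cd dp nP; have [i ip] := cover p.
apply: (chart_near_change hA (atlas_compatible hA i)) => //.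
by apply: is_chart_near => //; exact: atlas_is_chart.
Qed.

Lemma is_chart_continuous c p : is_chart c -> cdom c p ->
  {for p, continuous (cmap c)}.
Proof.
move=> [oc wc _ _] cp; move: wc; rewrite continuous_open_subspace //.
by apply; exact/mem_set.
Qed.

Let closed_ball_ (x : 'rV[R]_m) (e : R) : set 'rV[R]_m := [set y | `|y - x| <= e].

Let closed_ball_compact x e : compact (closed_ball_ x e).
Proof.
apply: bounded_closed_compact.
  exists (`|x| + e); split; first exact: num_real.
  move=> N lN y xy; apply: le_trans (ltW lN).
  rewrite -[y](subrK x) addrC; apply: le_trans (ler_normD _ _) _.
  by rewrite lerD2l.
have cn : continuous (fun y : 'rV[R]_m => `|y - x|).
  move=> y; apply: continuous_comp; last exact: norm_continuous.
  by apply: continuousB; [exact: cvg_id|exact: cst_continuous].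
rewrite (_ : closed_ball_ x e =
  (fun y : 'rV[R]_m => `|y - x|) @^-1` [set t | t <= e]) //.
by apply: closed_comp => [y _|]; [exact: cn|exact: closed_le].
Qed.

(** The set is the image of a compact ball under the inverse chart, hence compact, hence closed
    because [M] is Hausdorff. Without closedness in all of [M], extending a bump by 0 could fail to
    be smooth at points off the chart. *)
Lemma chart_closed_ball c p : is_chart c -> cdom c p -> exists2 e : R, 0 < e &
  closed [set q | cdom c q /\ `|cmap c q - cmap c p| <= e].
Proof.
move=> hc cp; have [oc _ _ co] := hc; have ci := is_chart_injective hc.
have oi : open (cmap c @` cdom c) by apply: co.
have : nbhs (cmap c p) (cmap c @` cdom c).
  by apply: open_nbhs_nbhs; split=> //; exists p.
move=> /nbhs_ballP[e /= e0 eb]; exists (e / 2); first by rewrite divr_gt0.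
have hT : hausdorff_space M by case: hM.
apply: (compact_closed hT).
pose g x : M := xget p [set q | cdom c q /\ cmap c q = x].
have gK q : cdom c q -> g (cmap c q) = q.
  move=> cq; apply: xget_unique; first by [].
  by move=> q' [cq' /(ci _ _ cq' cq)].
pose B := closed_ball_ (cmap c p) (e / 2).
have BI : B `<=` cmap c @` cdom c.
  move=> x Bx; apply: eb; rewrite -ball_normE /= distrC.
  by apply: le_lt_trans Bx _; rewrite ltr_pdivrMr // ltr_pMr // ltr1n.
have -> : [set q | cdom c q /\ `|cmap c q - cmap c p| <= e / 2] = g @` B.
  apply/seteqP; split=> [q [cq qB]|_ [x /[dup] Bx /BI [q cq qx] <-]].
    by exists (cmap c q) => //; exact: gK.
  by rewrite -qx gK //; split => //; move: Bx; rewrite -qx.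
apply: continuous_compact; last exact: closed_ball_compact.
apply: continuous_in_subspaceT => x /set_mem /BI [q cq <-].
move=> V; rewrite /= gK // => /(is_chart_near hc cq).
by apply: filterS => y [q' [cq' <- Vq']]; rewrite /= gK.
Qed.

(** A bump read in the chart and extended by 0: a point off the domain has a neighbourhood missing
    the closed set of [chart_closed_ball], and there the extension is 0. *)
Lemma manifold_bump c p : is_chart c -> compatible A c -> cdom c p ->
  exists f : M -> R^o, [/\ forall q, msmooth A f q,
    \forall q \near p, f q = 1 & supported_in A c f].
Proof.
move=> hc cc cp; have [e e0 clK] := chart_closed_ball hc cp.
have [b [sb b1 b0]] := smooth_bump (cmap c p) e0.
pose f q : R^o := if pselect (cdom c q) then b (cmap c q) else 0.
have fE q : cdom c q -> f q = b (cmap c q) by rewrite /f; case: pselect.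
have supf : supported_in A c f.
  move=> d q cd dq ncq; apply: near_chart_near => //.
  set K := [set q | _] in clK.
  have : \forall q' \near q, ~ K q'.
    by apply: (open_nbhs_nbhs (conj (closed_openC clK) _)) => -[].
  apply: filterS => q' nK; rewrite /f; case: pselect => // cq'.
  by apply: b0; rewrite ltNge; apply/negP => h; apply: nK.
exists f; split=> //.
- move=> q; have [cq|ncq] := pselect (cdom c q).
    apply: (msmooth_pullback cc cq (sb _)).
    by apply: chart_near_sub (chart_near_dom hA cc cc cq cq) => q' cq' _; exact: fE.
  have [i iq] := cover q; have ci := atlas_compatible hA i.
  apply: (msmooth_near_eq hA ci iq) (msmooth_cst hA (0 : R^o) q).
  by apply: chart_near_sub (supf _ _ ci iq ncq) => q' _ ->.
- have nc : \forall q \near p, cdom c q.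
    by apply: open_nbhs_nbhs; split => //; case: hc.
  have := near_comp (is_chart_continuous hc cp) b1.
  by apply: filterS2 nc => q cq bq; rewrite fE.
Qed.

(* No paracompactness is needed: multiplying the bumps by the factors
   [1 - f j], j < k, makes the family locally finite. *)
Lemma smooth_partition_exists (P : chart R m M -> Prop) :
  P (Chart set0 (fun=> 0)) ->
  (forall p, exists c, [/\ is_chart c, compatible A c, P c & cdom c p]) ->
  exists (c : nat -> chart R m M) (f : nat -> M -> R^o),
    smooth_partition A c f /\ forall k, P (c k).
Proof.
move=> P0 hP.
have [B /countable_injP[h hinj] [Bopen Bnbhs]] : second_countable (T := M)
  by case: hM.
pose good (cf : chart R m M * (M -> R^o)) :=
  [/\ compatible A cf.1, P cf.1, forall q,
    msmooth A cf.2 q & supported_in A cf.1 cf.2].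
(* The basic open sets are numbered by [h]. Number [n] receives a bump equal to 1 on its set if
   there is one, and otherwise the zero function on the empty chart; a single choice for each [n]
   then reaches every point. *)
have : forall n : nat, exists cf, good cf /\ forall V, B V -> h V = n ->
    (exists2 cf', good cf' & forall q, V q -> cf'.2 q = 1) ->
    forall q, V q -> cf.2 q = 1.
  move=> n; have [H|H] := pselect (exists V, [/\ B V, h V = n &
      exists2 cf', good cf' & forall q, V q -> cf'.2 q = 1]).
    have [V [BV hV [cf gcf cf1]]] := H; exists cf; split=> // V' BV' hV' _.
    suff -> : V' = V by [].
    by apply: hinj; rewrite ?inE // hV hV'.
  exists (Chart set0 (fun=> 0), fun=> 0); split; last first.
    by move=> V BV hV hcf; case: H; exists V.
  split=> //=.
  - split=> /= [p q []|i|i|i|i].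
    + rewrite set0I image_set0; exact: open0.
    + rewrite setI0 image_set0; exact: open0.
    + by move=> k; rewrite /= set0I image_set0; apply: smooth_at_on => x [].
    + by move=> k; rewrite /= setI0 image_set0; apply: smooth_at_on => x [].
  - by move=> q; exact: msmooth_cst.
  - move=> d q cd dq _.
    by apply: chart_near_sub (chart_near_dom hA cd cd dq dq).
move=> /choice[cf hcf].
pose f n : M -> R^o := (cf n).2.
have f1 p : exists n, \forall q \near p, f n q = 1.
  have [c [hc cc Pc cp]] := hP p.
  have [b [sb b1 bsup]] := manifold_bump hc cc cp.
  have [V [BV Vp] Vb] := Bnbhs p _ b1.
  exists (h V); have [_ /(_ V BV erefl) fV] := hcf (h V).
  apply: (filterS (fV _)).
    by exists (c, b) => //= q /Vb.
  by apply: open_nbhs_nbhs; split => //; exact: Bopen.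
have sf n q : msmooth A (f n) q by have [[]] := hcf n.
pose r n q : R^o := \prod_(0 <= k < n) (1 - f k q).
have rS n q : r n.+1 q = r n q * (1 - f n q) by rewrite /r big_nat_recr.
have sr n q : msmooth A (r n) q.
  elim: n => [|n IH].
    by apply: msmooth_ext (msmooth_cst hA (1 : R^o) q) => x; rewrite /r big_geq.
  apply: (msmooth_ext (F := fun q => r n q *: (1 - f n q))).
    by move=> x; rewrite rS.
  by apply: (msmooth_scale hA) => //; apply: (msmoothB hA) => //; exact: msmooth_cst.
pose g n q : R^o := f n q * r n q.
(* A telescoping sum; it equals 1 as soon as one of the factors of [r n q] vanishes. *)
have gsum n q : \sum_(0 <= k < n) g k q = 1 - r n q.
  elim: n => [|n IH]; first by rewrite /r !big_geq // subrr.
  by rewrite big_nat_recr //= IH rS /g; ring.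
have r0 n q k : f n q = 1 -> (n < k)%N -> r k q = 0.
  move=> fn nk; rewrite /r (big_cat_nat (n := n.+1)) //= big_nat_recr //=.
  by rewrite fn subrr mulr0 mul0r.
exists (fun n => (cf n).1), g; split; last by move=> k; have [[]] := hcf k.
split.
- by move=> k; have [[]] := hcf k.
- by move=> k q; apply: (msmooth_scale hA).
- move=> k d q cd dq ncq; have [[_ _ _ sup] _] := hcf k.
  by apply: chart_near_sub (sup _ _ cd dq ncq) => q' _ E; rewrite /g /f E mul0r.
move=> p; have [n fn] := f1 p; exists n.+1 => d cd dp.
apply: near_chart_near => //; apply: filterS fn => q fnq; split.
  by move=> k nk; rewrite /g (r0 n) ?mulr0.
by rewrite gsum (r0 n) // subr0.
Qed.

End SmoothManifold.

(** * The tangent bundle and complete lifts *)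

Section TangentBundleCharts.
Context {R : realType} {m : nat} {M : topologicalType} (A : atlas R m M).
Implicit Types (c d : chart R m M) (p q : M) (z : tbundle A) (W : normedModType R).

Local Notation T := (tatlas A).

Definition tchart c : chart R (m + m) (tbundle A) :=
  Chart [set z | cdom c (base z)]
        (fun z => row_mx (cmap c (base z)) (tcoord c (tvec z))).

(* [tc] agrees with [tchart c] on its domain; this also covers the charts of
   [tatlas A]. *)
Definition tchart_of c (tc : chart R (m + m) (tbundle A)) : Prop :=
  (forall z, cdom tc z <-> cdom c (base z)) /\
  forall z, cdom c (base z) ->
    cmap tc z = row_mx (cmap c (base z)) (tcoord c (tvec z)).

Lemma lsubmx_tchart c z : lsubmx (cmap (tchart c) z) = cmap c (base z).
Proof. exact: row_mxKl. Qed.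

Lemma rsubmx_tchart c z : rsubmx (cmap (tchart c) z) = tcoord c (tvec z).
Proof. exact: row_mxKr. Qed.

Lemma tchart_ofT c : tchart_of c (tchart c). Proof. by []. Qed.

Hypothesis hA : smooth_atlas A.

Let cover p : exists i, cdom (A i) p. Proof. by have [] := hA. Qed.

Let Ac i : compatible A (A i). Proof. exact: atlas_compatible. Qed.

Lemma tchart_of_atlas i : tchart_of (A i) (T i).
Proof. by split=> // z iz; rewrite /= /tchart_map tcoord_atlas. Qed.

Lemma tchart_of_injective c tc : compatible A c -> tchart_of c tc ->
  chart_injective tc.
Proof.
move=> cc [tcd tcm] z z' /tcd cz /tcd cz'.
rewrite !tcm //; move: z z' cz cz' => [p v] [q w] /= cp cq /eq_row_mx[pq].
have E := compatible_inj cc cp cq pq.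
by move: w cq pq; rewrite -E => w cq _ /(tcoord_inj hA cc cp) ->.
Qed.

Lemma chart_overlap_open c d : compatible A c -> compatible A d ->
  open (cmap c @` (cdom c `&` cdom d)).
Proof.
move=> cc cd; rewrite openE => _ [q [cq dq] <-].
apply: filterS (chart_near_dom hA cc cd cq dq) => y [q' [cq' <- dq']].
by exists q'.
Qed.

(** The image is a full cylinder over the overlap in the base, since [mkvec] realizes every fibre
    component. *)
Lemma tchart_of_image c d tc td : compatible A c -> tchart_of c tc ->
  tchart_of d td ->
  cmap tc @` (cdom tc `&` cdom td) =
  [set y | (cmap c @` (cdom c `&` cdom d)) (lsubmx y)].
Proof.
move=> cc [tcd tcm] [tdd tdm]; apply/seteqP; split=> [_ [z [/tcd cz /tdd dz] <-]|y].
  by exists (base z) => //; rewrite tcm // row_mxKl.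
move=> [p [cp dp] py].
exists (TVec (mkvec A c p (rsubmx y))); first by split; [apply/tcd|apply/tdd].
by rewrite tcm //= (mkvecK hA _ cc cp) py hsubmxK.
Qed.

Lemma tchart_of_open c d tc td : compatible A c -> compatible A d ->
  tchart_of c tc -> tchart_of d td -> open (cmap tc @` (cdom tc `&` cdom td)).
Proof.
move=> cc cd tcc tdd; rewrite (tchart_of_image cc tcc tdd).
apply: (@open_comp _ _ (lsubmx : 'rV[R]_(m + m) -> 'rV[R]_m)).
  by move=> y _; exact: smooth_at_continuous (smooth_at_lsubmx y).
exact: chart_overlap_open.
Qed.

(** The transition map is [tlift] of the one on the base, by the change of components of tangent
    vectors. *)
Lemma tchart_of_transition c d tc td : compatible A c -> compatible A d ->
  tchart_of c tc -> tchart_of d td -> smooth_transition tc td.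
Proof.
move=> cc cd tcc tdd; apply: smooth_at_on => y Iy.
have [z [cz' dz'] zy] := Iy.
have cz := proj1 (tcc.1 z) cz'; have dz := proj1 (tdd.1 z) dz'.
have ly : lsubmx y = cmap c (base z) by rewrite -zy (tcc.2 _ cz) row_mxKl.
have st : smooth_at (tlift (local_rep c (cmap d))) y.
  by apply: smooth_at_tlift; rewrite ly; exact: smooth_at_transition.
apply: smooth_at_near_eq st.
have : \forall y' \near y, (cmap tc @` (cdom tc `&` cdom td)) y'.
  by apply: open_nbhs_nbhs; split=> //; exact: tchart_of_open tcc tdd.
apply: filterS => _ [z' [tcz' tdz'] <-].
have cz1 := proj1 (tcc.1 z') tcz'; have dz1 := proj1 (tdd.1 z') tdz'.
rewrite (local_repE _ (tchart_of_injective cc tcc) tcz').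
rewrite (tcc.2 _ cz1) (tdd.2 _ dz1) /tlift row_mxKl row_mxKr.
rewrite (local_repE _ (compatible_inj cc) cz1).
by rewrite -(tcoord_change hA _ cc cd cz1 dz1).
Qed.

Lemma tchart_of_compatible c tc : compatible A c -> tchart_of c tc ->
  compatible T tc.
Proof.
move=> cc tcc; split=> [|i|i|i|i].
- exact: tchart_of_injective tcc.
- exact: tchart_of_open cc (Ac i) tcc (tchart_of_atlas i).
- exact: tchart_of_open (Ac i) cc (tchart_of_atlas i) tcc.
- exact: tchart_of_transition cc (Ac i) tcc (tchart_of_atlas i).
- exact: tchart_of_transition (Ac i) cc (tchart_of_atlas i) tcc.
Qed.

Lemma smooth_tatlas : smooth_atlas T.
Proof.
split=> [z|i]; first by have [i iz] := cover (base z); exists i.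
exact: tchart_of_compatible (Ac i) (tchart_of_atlas i).
Qed.

Let hT := smooth_tatlas.

Lemma tchart_compatible c : compatible A c -> compatible T (tchart c).
Proof. by move=> cc; exact: tchart_of_compatible cc (tchart_ofT c). Qed.

Lemma tchart_near c z (P : M -> Prop) : chart_near P c (base z) ->
  compatible A c -> cdom c (base z) ->
  chart_near (fun z' => P (base z')) (tchart c) z.
Proof.
move=> nP cc cz; rewrite /chart_near.
have cl := smooth_at_continuous (smooth_at_lsubmx (cmap (tchart c) z)).
have := near_comp cl; rewrite lsubmx_tchart => /(_ _ nP).
apply: filterS => y [q [cq qy Pq]].
exists (TVec (mkvec A c q (rsubmx y))); split=> //=.
by rewrite (mkvecK hA _ cc cq) qy hsubmxK.
Qed.

Lemma msmooth_base W (F : M -> W) z : msmooth A F (base z) ->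
  msmooth T (fun z' => F (base z')) z.
Proof.
move=> sF; have [i iz] := cover (base z).
have sl := msmooth_chart hA (Ac i) iz sF.
apply: (@msmooth_pullback _ _ _ T (tchart (A i)) z _ _
  (fun y => local_rep (A i) F (lsubmx y))) => //.
- exact: tchart_compatible.
- by apply: smooth_at_base; rewrite /= row_mxKl.
apply: chart_near_sub (tchart_near (chart_near_dom hA (Ac i) (Ac i) iz iz)
  (Ac i) iz).
move=> z' iz' _ /=; rewrite row_mxKl local_repE //.
exact: compatible_inj.
Qed.

Lemma fiber_pullback c W (F : M -> W) z : compatible A c -> cdom c (base z) ->
  msmooth A F (base z) ->
  chart_near (fun z' => tderiv (tvec z') F =
    'D_(rsubmx (cmap (tchart c) z')) (local_rep c F) (lsubmx (cmap (tchart c) z')))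
    (tchart c) z.
Proof.
move=> cc cz sF.
apply: chart_near_sub (tchart_near (msmooth_chart_near hA cc cz sF) cc cz).
move=> z' cz' sF'; rewrite /= row_mxKl row_mxKr.
exact: tderivE.
Qed.

Lemma smooth_at_fiber_chart c W (F : M -> W) z : compatible A c ->
  cdom c (base z) -> msmooth A F (base z) ->
  smooth_at (fun y => 'D_(rsubmx y) (local_rep c F) (lsubmx y)) (cmap (tchart c) z).
Proof.
move=> cc cz sF; apply: smooth_at_fiber; rewrite /= row_mxKl.
exact: msmooth_chart.
Qed.

Lemma msmooth_fiber W (F : M -> W) z : msmooth A F (base z) ->
  msmooth T (fun z' => tderiv (tvec z') F) z.
Proof.
move=> sF; have [i iz] := cover (base z).
apply: (msmooth_pullback (tchart_compatible (Ac i)) _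
  (smooth_at_fiber_chart (Ac i) iz sF)) => //.
exact: fiber_pullback.
Qed.

(** In the induced chart the complete lift of [F] is [(x, v) |-> 'D_v F x]. Its differential takes a
    second derivative in the horizontal direction and a first derivative in the vertical one; all
    computations with lifted functions rest on this. *)
Lemma tderiv_fiber c W (F : M -> W) z (w : tangent T z) : compatible A c ->
  cdom c (base z) -> msmooth A F (base z) ->
  tderiv w (fun z' => tderiv (tvec z') F) =
  'D_(lsubmx (tcoord (tchart c) w)) ('D_(tcoord c (tvec z)) (local_rep c F))
    (cmap c (base z)) +
  'D_(rsubmx (tcoord (tchart c) w)) (local_rep c F) (cmap c (base z)).
Proof.
move=> cc cz sF; have sl := msmooth_chart hA cc cz sF.
have sl' : smooth_at (local_rep c F) (lsubmx (cmap (tchart c) z)).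
  by rewrite /= row_mxKl.
rewrite (tderiv_pullback hT w (tchart_compatible cc) _
  (smooth_at_fiber_chart cc cz sF) (fiber_pullback cc cz sF)) //.
have := derive_fiber (tcoord (tchart c) w) sl'.
by rewrite lsubmx_tchart rsubmx_tchart.
Qed.

(** The differential of [tlift t]. Its second-order term is what makes the independence of chart of
    the lifts a matter of mixed derivatives. *)
Lemma tcoord_tchart_change c d z (w : tangent T z) : compatible A c ->
  compatible A d -> cdom c (base z) -> cdom d (base z) ->
  let a := lsubmx (tcoord (tchart c) w) in
  let b := rsubmx (tcoord (tchart c) w) in
  let t := local_rep c (cmap d) in
  tcoord (tchart d) w = row_mx ('D_a t (cmap c (base z)))
    ('D_a ('D_(tcoord c (tvec z)) t) (cmap c (base z)) + 'D_b t (cmap c (base z))).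
Proof.
move=> cc cd cz dz a b t.
have st : smooth_at t (cmap c (base z)) by exact: smooth_at_transition.
have st' : smooth_at t (lsubmx (cmap (tchart c) z)) by rewrite /= row_mxKl.
have cT := tchart_compatible cc.
rewrite /tcoord (@tderiv_pullback _ _ _ T hT (tchart c) z w _ _ (tlift t) cT) //.
- have := derive_tlift (tcoord (tchart c) w) st'.
  by rewrite lsubmx_tchart rsubmx_tchart.
- exact: smooth_at_tlift.
apply: chart_near_sub (tchart_near (chart_near_dom hA cc cd cz dz) cc cz).
move=> z' cz' dz'; rewrite /tlift /= row_mxKl row_mxKr.
rewrite {1}/t (local_repE _ (compatible_inj cc) cz').
congr row_mx; exact: (tcoord_change hA _ cc cd cz' dz').
Qed.

(** * The lift of an endomorphism field *)

Section LiftEndo.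
Variable J : endo_field A.
Hypothesis hJ : forall p, exists c, exists K,
  [/\ compatible A c, cdom c p & constant_in J c K].

Let ac p := projT1 (cid (hJ p)).
Let aK p := projT1 (cid (projT2 (cid (hJ p)))).

Let acP p : [/\ compatible A (ac p), cdom (ac p) p & constant_in J (ac p) (aK p)].
Proof. exact: (projT2 (cid (projT2 (cid (hJ p))))). Qed.

Definition block_diag (K : 'M[R]_m) : 'M[R]_(m + m) := block_mx K 0 0 K.

Lemma row_mx_block_diag (a b : 'rV[R]_m) K :
  row_mx a b *m block_diag K = row_mx (a *m K) (b *m K).
Proof. by rewrite mul_row_block !mulmx0 add0r addr0. Qed.

(** Written in the adapted chart chosen at the base point; [constant_in_lift_endo] removes the
    dependence on that choice. *)
Definition lift_endo_fun z (w : tangent T z) : tangent T z :=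
  mkvec T (tchart (ac (base z))) z
    (tcoord (tchart (ac (base z))) w *m block_diag (aK (base z))).

Lemma lift_endo_linear z : linear (@lift_endo_fun z).
Proof.
have [cc cz _] := acP (base z); have cT := tchart_compatible cc.
move=> t u w; rewrite /lift_endo_fun (tcoord_linear hT t u w cT cz).
by rewrite mulmxDl -scalemxAl (mkvec_linear hT _ _ _ cT cz).
Qed.

(* The complete lift of [J]: in the charts induced by charts where [J] has
   constant matrix [K], its matrix is [block_diag K]. *)
Definition lift_endo : endo_field T := fun z =>
  HB.pack (@lift_endo_fun z)
    (GRing.isLinear.Build R _ _ _ (@lift_endo_fun z) (@lift_endo_linear z)).

(** [K] and [L] both represent [J] at [q]. Since the relation holds on the whole overlap of the
    charts, it may be differentiated. *)
Lemma constant_in_intertwine c d K L q u : compatible A c -> compatible A d ->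
  cdom c q -> cdom d q -> constant_in J c K -> constant_in J d L ->
  'D_(u *m K) (local_rep c (cmap d)) (cmap c q) =
  'D_u (local_rep c (cmap d)) (cmap c q) *m L.
Proof.
move=> cc cd cq dq JK JL; set t := local_rep c (cmap d).
pose v := mkvec A c q u; have vE : tcoord c v = u := mkvecK hA u cc cq.
have vE' : tcoord d v = 'D_u t (cmap c q).
  exact: etrans (tcoord_change hA v cc cd cq dq) (congr1 (fun a => 'D_a t _) vE).
have JE : tcoord c (J q v) = u *m K.
  exact: etrans (JK q v cq) (congr1 (mulmxr K) vE).
apply: etrans (congr1 (fun a => 'D_a t (cmap c q)) (esym JE)) _.
apply: etrans (esym (tcoord_change hA (J q v) cc cd cq dq)) _.
exact: etrans (JL q v dq) (congr1 (mulmxr L) vE').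
Qed.

(** The point [z] brings its own chosen chart [d], so the lift has to be transported from [d] to
    [c]. The first-order terms agree by [constant_in_intertwine], the second-order term by its
    derivative along the fibre vector. *)
Lemma constant_in_lift_endo c K : compatible A c -> constant_in J c K ->
  constant_in lift_endo (tchart c) (block_diag K).
Proof.
move=> cc JK z w cz.
have [cd dz JL] := acP (base z); set d := ac _ in cd dz JL; set L := aK _ in JL.
have dT := tchart_compatible cd.
have Ew : tcoord (tchart d) (lift_endo z w) = tcoord (tchart d) w *m block_diag L.
  exact: (mkvecK hT _ dT dz).
move: (lift_endo z w) Ew => w' Ew.
apply: etrans (tcoord_tchart_change w' cd cc dz cz) _.
apply: etrans _ (congr1 (mulmxr (block_diag K))
  (esym (tcoord_tchart_change w cd cc dz cz))).
rewrite Ew /= row_mx_block_diag.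
set t := local_rep d (cmap c); set x := cmap d (base z).
rewrite -[tcoord (tchart d) w]hsubmxK row_mx_block_diag !row_mxKl !row_mxKr.
set a := lsubmx _; set b := rsubmx _; set v := tcoord d _.
have st : smooth_at t x by exact: smooth_at_transition.
rewrite !(constant_in_intertwine _ cd cc dz cz JL JK) mulmxDl.
congr (row_mx _ (_ + _)).
(* Exchanging the derivatives puts the direction multiplied by [L] innermost, where the intertwining
   relation trades [L] for the constant factor [K]. *)
apply: etrans (derive_comm _ _ st) _.
apply: etrans _ (congr1 (mulmxr K) (derive_comm v a st)).
apply: etrans _ (derive_mulmxr K v (smooth_at_derive a st)).
apply: near_eq_derive.
apply: (chart_near_eq (chart_near_dom hA cd cc dz cz)) => q dq cq.
exact: constant_in_intertwine.
Qed.

Lemma smooth_lift_endo : smooth_endo_field lift_endo.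
Proof.
apply: (smooth_endo_field_constant hT) => z; have [cc cz JK] := acP (base z).
exists (tchart (ac (base z))), (block_diag (aK (base z))).
split=> //; first exact: tchart_compatible.
exact: constant_in_lift_endo.
Qed.

End LiftEndo.

(** * The lift of a vector field *)

Section LiftVectorField.
Variables (Z : vfield A).
Hypothesis sZ : forall p, vsmooth Z p.

Let ai p := projT1 (cid (cover p)).
Let aiP p : cdom (A (ai p)) p. Proof. exact: (projT2 (cid (cover p))). Qed.

(** In induced coordinates [(x, v)] the complete lift has the components [Z x] and ['D_v Z x]; they
    are written here in a chart of the atlas chosen at the base point. *)
Definition lift_vfield : vfield T := fun z =>
  mkvec T (tchart (A (ai (base z)))) z
    (row_mx (tcoord (A (ai (base z))) (Z (base z)))
            (tderiv (tvec z) (fun q => tcoord (A (ai (base z))) (Z q)))).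

(* The hypothesis is the symmetry of second derivatives, needed for values in
   row vectors and in [R^o], neither of which is an instance of the other. *)
Lemma tderiv_lift_vfield_fiber W (F : M -> W) z :
  (forall (f : 'rV[R]_m -> W) x u v, smooth_at f x ->
     'D_u ('D_v f) x = 'D_v ('D_u f) x) ->
  msmooth A F (base z) ->
  tderiv (lift_vfield z) (fun z' => tderiv (tvec z') F) =
  tderiv (tvec z) (fun q => tderiv (Z q) F).
Proof.
move=> comm sF; have iz := aiP (base z); set i := ai _ in iz.
have ci := Ac i; have ii := compatible_inj ci.
have sl := msmooth_chart hA ci iz sF.
have sZi := vsmooth_chart hA ci iz (sZ (base z)).
have sZl := msmooth_chart hA ci iz sZi.
rewrite (tderiv_fiber _ ci iz sF) (mkvecK hT _ (tchart_compatible ci) iz).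
rewrite row_mxKl row_mxKr (comm _ _ _ _ sl).
rewrite (tderivE hA _ ci iz (msmooth_tderiv hA (sZ (base z)) sF)).
rewrite (tderivE hA _ ci iz sZi).
set v := tcoord (A i) (tvec z).
have := derive_along v sl (smooth_at_id _) sZl.
rewrite derive_id (local_repE _ ii iz) => <-.
apply: near_eq_derive; apply: (chart_near_eq (msmooth_chart_near hA ci iz sF)) => q iq sq.
by rewrite !(local_repE _ ii iq) (tderivE hA _ ci iq sq).
Qed.

(** Independence of the chosen chart: the fibre component in [c] is the derivative of the complete
    lift of the vector-valued function [cmap c], so the formula for lifted functions applies to
    it. *)
Lemma tcoord_lift_vfield c z : compatible A c -> cdom c (base z) ->
  tcoord (tchart c) (lift_vfield z) =
  row_mx (tcoord c (Z (base z))) (tderiv (tvec z) (fun q => tcoord c (Z q))).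
Proof.
move=> cc cz; have iz := aiP (base z); set i := ai _ in iz; have ci := Ac i.
have sc := msmooth_cmap hA cc cz.
rewrite (tcoord_tchart_change _ ci cc iz cz).
rewrite (mkvecK hT _ (tchart_compatible ci) iz) row_mxKl row_mxKr.
congr row_mx; first by rewrite -(tcoord_change hA _ ci cc iz cz).
rewrite -[RHS](tderiv_lift_vfield_fiber _ sc); last by move=> f x u v;
  exact: derive_comm.
rewrite (tderiv_fiber _ ci iz sc) (mkvecK hT _ (tchart_compatible ci) iz).
by rewrite row_mxKl row_mxKr.
Qed.

Lemma vsmooth_lift_vfield z : vsmooth lift_vfield z.
Proof.
have [i iz] := cover (base z); have ci := Ac i; have cT := tchart_compatible ci.
have sZi := vsmooth_chart hA ci iz (sZ (base z)).
exists (tchart (A i)); split=> //.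
apply: (msmooth_near_eq hT cT iz) (msmooth_row_mx hT (msmooth_base sZi)
  (msmooth_fiber sZi)).
apply: chart_near_sub (chart_near_dom hT cT cT iz iz) => z' iz' _.
by rewrite (tcoord_lift_vfield ci iz').
Qed.

Lemma lifts_lift_vfield : lifts_vfield Z lift_vfield.
Proof.
split; first by apply/(smooth_vfieldP hT); exact: vsmooth_lift_vfield.
move=> f /(smooth_funP hA) sf z.
exact: (@tderiv_lift_vfield_fiber R^o f z (@derive_comm_real R m) (sf _)).
Qed.

End LiftVectorField.

End TangentBundleCharts.

Section ZeroFiber.
Context {R : realType} {m : nat}.

(* Used to extend an identity from the nonzero tangent vectors to the zero
   section. *)
Lemma zero_fiber_limit (W : normedModType R) (F : 'rV[R]_(m + m) -> W)
    (x e : 'rV[R]_m) : e != 0 -> {for row_mx x 0, continuous F} ->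
  (forall v, v != 0 -> F (row_mx x v) = 0) -> F (row_mx x 0) = 0.
Proof.
move=> e0 cF F0; apply/eqP/negPn/negP => Fn0.
pose s (t : R) := row_mx x (t *: e).
have cs : {for 0 : R, continuous s}.
  have -> : s = (fun t => row_mx x 0 + t *: row_mx 0 e).
    by apply/funext => t; rewrite scale_row_mx scaler0 add_row_mx addr0 add0r.
  apply: continuousD; first exact: cst_continuous.
  exact: scalel_continuous.
have s0 : s 0 = row_mx x 0 by rewrite /s scale0r.
have nF : \forall y \near s 0, `|F (row_mx x 0) - F y| < `|F (row_mx x 0)|.
  by rewrite s0; move/cvgr_dist_lt: cF; apply; rewrite normr_gt0.
have := near_comp cs nF => /nbhs_ballP[r /= r0 rP].
have r2 : r / 2 != 0 by rewrite gt_eqF // divr_gt0.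
have := rP (r / 2); rewrite -ball_normE /= sub0r normrN ger0_norm; last first.
  by rewrite divr_ge0 // ltW.
rewrite ltr_pdivrMr // ltr_pMr // ltr1n => /(_ isT).
have te : (r / 2) *: e != 0 by rewrite scaler_eq0 negb_or r2.
by rewrite /s (F0 _ te) subr0 ltxx.
Qed.

End ZeroFiber.

(** * Uniqueness of complete lifts *)

Section Uniqueness.
Context {R : realType} {m : nat} {M : topologicalType} (A : atlas R m M).
Implicit Types (c d : chart R m M) (p q : M) (z : tbundle A).
Hypothesis hM : smooth_manifold A.

Local Notation T := (tatlas A).

Let hA := smooth_manifold_atlas hM.
Let hT := smooth_tatlas hA.
Let cover p : exists i, cdom (A i) p. Proof. by have [] := hA. Qed.
Let Ac i : compatible A (A i). Proof. exact: atlas_compatible. Qed.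
Let Ai i : chart_injective (A i). Proof. exact: compatible_inj (Ac i). Qed.
Let Tc i : compatible T (tchart A (A i)). Proof. exact: tchart_compatible. Qed.

(** Lifts are tested on global fields and functions, so a local expression is multiplied by a bump,
    which leaves it unchanged near [p]. *)
Lemma extend_vfield i p (g : 'rV[R]_m -> 'rV[R]_m) : cdom (A i) p ->
  (forall y, smooth_at g y) -> exists Z : vfield A, (forall q, vsmooth Z q) /\
    chart_near (fun q => tcoord (A i) (Z q) = g (cmap (A i) q)) (A i) p.
Proof.
move=> ip sg; have [f [sf f1 fs]] := manifold_bump hM (atlas_is_chart hM i)
  (Ac i) ip.
exists (fun q => f q *: mkvec A (A i) q (g (cmap (A i) q))).
have E q : cdom (A i) q ->
    tcoord (A i) (f q *: mkvec A (A i) q (g (cmap (A i) q))) =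
    f q *: g (cmap (A i) q).
  move=> iq; apply: etrans (tcoordZ hA _ _ (Ac i) iq) _.
  by congr (_ *: _); exact: mkvecK.
split; last first.
  have f1' := near_chart_near hM (Ac i) ip f1.
  by apply: chart_near_sub f1' => q iq fq; rewrite E // fq scale1r.
move=> q; have [iq|niq] := pselect (cdom (A i) q).
  exists (A i); split=> //.
  apply: (msmooth_near_eq hA (Ac i) iq) (msmooth_scale hA (sf q)
    (msmooth_comp hA (msmooth_cmap hA (Ac i) iq) (sg _))).
  by apply: chart_near_sub (chart_near_dom hA (Ac i) (Ac i) iq iq) => q' iq' _;
    rewrite E.
have [j jq] := cover q; exists (A j); split=> //.
apply: (msmooth_near_eq hA (Ac j) jq) (msmooth_cst hA (0 : 'rV[R]_m) q).
apply: chart_near_sub (fs _ _ (Ac j) jq niq) => q' jq' ->.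
by rewrite scale0r (tcoord0 hA (Ac j) jq').
Qed.

Lemma extend_function i p (g : 'rV[R]_m -> R^o) : cdom (A i) p ->
  (forall y, smooth_at g y) -> exists f : M -> R^o, (forall q, msmooth A f q) /\
    chart_near (fun q => f q = g (cmap (A i) q)) (A i) p.
Proof.
move=> ip sg; have [f [sf f1 fs]] := manifold_bump hM (atlas_is_chart hM i)
  (Ac i) ip.
exists (fun q => f q *: g (cmap (A i) q)); split; last first.
  have f1' := near_chart_near hM (Ac i) ip f1.
  by apply: chart_near_sub f1' => q iq ->; rewrite scale1r.
move=> q; have [iq|niq] := pselect (cdom (A i) q).
  exact: (msmooth_scale hA (sf q)
    (msmooth_comp hA (msmooth_cmap hA (Ac i) iq) (sg _))).
have [j jq] := cover q.
apply: (msmooth_near_eq hA (Ac j) jq) (msmooth_cst hA (0 : R^o) q).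
by apply: chart_near_sub (fs _ _ (Ac j) jq niq) => q' jq' ->; rewrite scale0r.
Qed.

(* Testing on (extensions of) linear and quadratic functions; at [tvec z = 0]
   the lifts of functions do not see the horizontal part of [u]. *)
Lemma eq0_lift_fun i z (u : tangent T z) : cdom (A i) (base z) ->
  tcoord (A i) (tvec z) != 0 ->
  (forall f : M -> R, smooth_fun A f -> tderiv u (lift_fun f : _ -> R^o) = 0) ->
  u = 0.
Proof.
move=> iz v0 hu; set v := tcoord _ _ in v0.
set a := lsubmx (tcoord (tchart A (A i)) u).
set b := rsubmx (tcoord (tchart A (A i)) u).
set x := cmap (A i) (base z).
have main (g : 'rV[R]_m -> R^o) : (forall y, smooth_at g y) ->
    'D_a ('D_v g) x + 'D_b g x = 0.
  move=> sg; have [f [sf fg]] := extend_function iz sg.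
  have fE : \forall y \near x, local_rep (A i) f y = g y.
    apply: (chart_near_eq fg) => q iq <-; exact: local_repE.
  have E1 : 'D_a ('D_v g) x = 'D_a ('D_v (local_rep (A i) f)) x.
    apply: near_eq_derive; apply: filterS (nbhs_interior fE) => y fE'.
    by apply: near_eq_derive; apply: filterS fE' => y' ->.
  have E2 : 'D_b g x = 'D_b (local_rep (A i) f) x.
    by apply: near_eq_derive; apply: filterS fE => y ->.
  apply: etrans (congr2 +%R E1 E2) _.
  apply: etrans _ (hu f ((smooth_funP hA f).2 sf)).
  exact: esym (tderiv_fiber hA u (Ac i) iz (sf (base z))).
have lin j y w : 'D_w (mxentry 0 j : 'rV[R]_m -> R^o) y = w 0 j.
  exact: (derive_mx_linear (mxentry 0 j : {linear 'rV[R]_m -> R^o})).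
have slin j y : smooth_at (mxentry 0 j : 'rV[R]_m -> R^o) y.
  exact: (smooth_at_linear (mxentry 0 j : {linear 'rV[R]_m -> R^o})).
have Dlin j w : 'D_w (mxentry 0 j : 'rV[R]_m -> R^o) = (fun=> w 0 j).
  by apply/funext => y; exact: lin.
have b0 j : b 0 j = 0.
  have := main _ (slin j); rewrite Dlin lin.
  by rewrite derive_cst add0r.
(* With [b = 0], the product of two coordinates gives these equations. For [j = k] with [v 0 k]
   nonzero they yield [a 0 k = 0], and then every [a 0 j] vanishes. *)
have quad j k : a 0 j * v 0 k + a 0 k * v 0 j = 0.
  have sq y := smooth_at_scale (slin j y) (slin k y).
  have Dq w y : 'D_w (fun y : 'rV[R]_m => (mxentry 0 j y : R^o) *:
    (mxentry 0 k y : R^o)) y =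
      mxentry 0 j y * w 0 k + w 0 j * mxentry 0 k y.
    rewrite derive_scale ?lin //; exact: smooth_at_differentiable (slin _ _).
  have Dq' : 'D_v (fun y : 'rV[R]_m => (mxentry 0 j y : R^o) *:
    (mxentry 0 k y : R^o)) =
      (v 0 k \*: (mxentry 0 j : 'rV[R]_m -> R^o)) + (v 0 j \*:
        (mxentry 0 k : 'rV[R]_m -> R^o)).
    apply/funext => y; rewrite Dq mulrC; congr (_ + _).
  have := main _ sq; rewrite Dq Dq' !b0 mulr0 mul0r addr0 addr0.
  have dlin l : derivable (mxentry 0 l : 'rV[R]_m -> R^o) x a.
    exact: diff_derivable (smooth_at_differentiable (slin l x)).
  rewrite deriveD; [|exact: derivableZ|exact: derivableZ].
  by rewrite !deriveZ // !lin => <-; rewrite mulrC [a 0 k * _]mulrC.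
have [k vk] : exists k, v 0 k != 0.
  apply/not_existsP => H; move/eqP: v0; apply; apply/rowP => k; rewrite mxE.
  by apply/eqP/negPn/negP; exact: H.
have ak : a 0 k = 0.
  have := quad k k; rewrite -mulr2n => /eqP;
    rewrite mulrn_eq0 /= mulf_eq0 (negbTE vk) orbF.
  by move/eqP.
have a0 j : a 0 j = 0.
  have := quad j k; rewrite ak mul0r addr0 => /eqP.
  by rewrite mulf_eq0 (negbTE vk) orbF => /eqP.
apply: (tcoord_inj hT (Tc i) iz); rewrite (tcoord0 hT (Tc i) iz).
rewrite -[LHS]hsubmxK -/a -/b -[RHS](@row_mx0 _ 1 m m).
have az : a = 0 by apply/rowP => j; rewrite [RHS]mxE; exact: a0.
have bz : b = 0 by apply/rowP => j; rewrite [RHS]mxE; exact: b0.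
by rewrite az bz.
Qed.

(** Settles dimension 0, where there are no nonzero vectors from which to approach the zero
    section. *)
Lemma trivial_tangent z (w w' : tangent T z) : (forall e : 'rV[R]_m, e = 0)
  -> w = w'.
Proof.
move=> e0; have [i iz] := cover (base z); apply: (tcoord_inj hT (Tc i) iz).
by rewrite -[LHS]hsubmxK -[RHS]hsubmxK; congr row_mx; rewrite [LHS]e0 [RHS]e0.
Qed.

(** Two lifts act alike on lifted functions, so [eq0_lift_fun] applies to their difference at
    nonzero vectors; a zero vector is approached within its fibre. *)
Lemma lifts_vfield_unique (Z : vfield A) (Z1 Z2 : vfield T) :
  lifts_vfield Z Z1 -> lifts_vfield Z Z2 -> forall z, Z1 z = Z2 z.
Proof.
move=> [/(smooth_vfieldP hT) s1 l1] [/(smooth_vfieldP hT) s2 l2] z.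
have [e0|/existsNP[e /eqP e0]] := pselect (forall e : 'rV[R]_m, e = 0).
  exact: trivial_tangent.
have off z' : tvec z' != 0 -> Z1 z' - Z2 z' = 0.
  move=> z'0; have [i iz] := cover (base z').
  apply: (eq0_lift_fun iz).
    by apply: contra_neq z'0 => h; apply: (tcoord_inj hA (Ac i) iz);
      rewrite h (tcoord0 hA (Ac i) iz).
  move=> f sf; have sL : msmooth T (lift_fun f : tbundle A -> R^o) z'.
    by apply: (msmooth_fiber hA); exact: (smooth_funP hA f).1.
  have := tderiv_linear hT (-1) (Z2 z') (Z1 z') sL.
  rewrite scaleN1r addrC => ->.
  have := l1 f sf z'; have := l2 f sf z'; rewrite /vderiv => -> ->.
  by rewrite scaleN1r addNr.
have [i iz] := cover (base z); apply: (tcoord_inj hT (Tc i) iz).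
apply/eqP; rewrite -subr_eq0 -(tcoordB hT _ _ (Tc i) iz); apply/eqP.
have cF := smooth_at_continuous (msmooth_chart hT (Tc i) iz (msmoothB hT
  (vsmooth_chart hT (Tc i) iz (s1 z)) (vsmooth_chart hT (Tc i) iz (s2 z)))).
have Ti := compatible_inj (Tc i).
have [/eqP z0|z0] := boolP (tvec z == 0);
  last by rewrite off // (tcoord0 hT (Tc i) iz).
have zE : cmap (tchart A (A i)) z = row_mx (cmap (A i) (base z)) 0.
  by rewrite /= z0 (tcoord0 hA (Ac i) iz).
rewrite (tcoordB hT _ _ (Tc i) iz).
rewrite -(local_repE (fun z => tcoord (tchart A (A i)) (Z1 z) -
  tcoord (tchart A (A i)) (Z2 z)) Ti iz) zE.
rewrite zE in cF; apply: (zero_fiber_limit e0 cF) => v v0.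
pose z' := TVec (mkvec A (A i) (base z) v).
have vE : tcoord (A i) (tvec z') = v by exact: mkvecK.
have -> : row_mx (cmap (A i) (base z)) v = cmap (tchart A (A i)) z'.
  by rewrite /= vE.
rewrite (local_repE _ Ti) //.
have iz' : cdom (tchart A (A i)) z' by [].
rewrite -(tcoordB hT (Z1 z') (Z2 z') (Tc i) iz') off ?(tcoord0 hT (Tc i) iz') //.
by apply: contra_neq v0 => z'0; rewrite -vE z'0 (tcoord0 hA (Ac i) iz).
Qed.

Lemma complete_lift_lift_vfield (Z : vfield A) : smooth_vfield Z ->
  complete_lift_vfield Z (lift_vfield hA Z).
Proof.
move=> /(smooth_vfieldP hA) sZ; split; first exact: lifts_lift_vfield.
move=> Z' hZ'; apply: lifts_vfield_unique hZ' _.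
exact: lifts_lift_vfield.
Qed.

Lemma lift_vfield_surj z (w : tangent T z) : tvec z != 0 ->
  exists Z : vfield A, smooth_vfield Z /\ lift_vfield hA Z z = w.
Proof.
move=> z0; have [i iz] := cover (base z); set x := cmap (A i) (base z).
pose v := tcoord (A i) (tvec z).
have [k vk] : exists k, v 0 k != 0.
  apply/not_existsP => H; move/eqP: z0; apply; apply: (tcoord_inj hA (Ac i) iz).
  rewrite (tcoord0 hA (Ac i) iz); apply/rowP => k; rewrite [RHS]mxE.
  by apply/eqP/negPn/negP; exact: H.
pose a := lsubmx (tcoord (tchart A (A i)) w).
pose b := rsubmx (tcoord (tchart A (A i)) w).
(* A rank-one matrix sending [v] to [b]. The affine field [y |-> a + (y - x) N] then has the value
   [a] at [x] and the derivative [b] along [v]. *)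
pose N : 'M[R]_m := (v 0 k)^-1 *: (delta_mx k 0 *m b).
have vN : v *m N = b.
  rewrite /N -scalemxAr mulmxA -colE (mx11_scalar (col k v)) mul_scalar_mx mxE.
  by rewrite scalerA mulVf // scale1r.
pose g (y : 'rV[R]_m) := (a - x *m N) + y *m N.
have sN y : smooth_at (fun y : 'rV[R]_m => y *m N) y.
  exact/smooth_at_mulmxr/smooth_at_id.
have sg y : smooth_at g y by apply: smooth_atD => //; exact: smooth_at_cst.
have [Z [sZ ZE]] := extend_vfield iz sg.
exists Z; split; first exact/(smooth_vfieldP hA).
apply: (tcoord_inj hT (Tc i) iz).
apply: etrans (tcoord_lift_vfield hA sZ (Ac i) iz) _.
rewrite -[RHS]hsubmxK; congr row_mx.
  have -> := chart_near_self (@Ai i) iz ZE.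
  by rewrite /g -/x subrK.
rewrite (tderiv_pullback hA (tvec z) (Ac i) iz (sg _) ZE) -/v -/x -/b -vN.
have := derive_mulmxr N v (smooth_at_id x); rewrite derive_id => <-.
rewrite /g (@deriveD _ _ _ (cst (a - x *m N)) (fun y => y *m N)).
- by rewrite derive_cst add0r.
- exact: derivable_cst.
- exact/diff_derivable/smooth_at_differentiable.
Qed.

Lemma smooth_endo_field_eq (J1 J2 : endo_field T) :
  smooth_endo_field J1 -> smooth_endo_field J2 ->
  (forall z w, tvec z != 0 -> J1 z w = J2 z w) -> forall z w, J1 z w = J2 z w.
Proof.
move=> [K1 hK1] [K2 hK2] J12 z w.
have [e0|/existsNP[e /eqP e0]] := pselect (forall e : 'rV[R]_m, e = 0).
  exact: trivial_tangent.
have [i iz] := cover (base z); have [s1 E1] := hK1 i; have [s2 E2] := hK2 i.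
have cTi := atlas_compatible hT i; have Ti := compatible_inj cTi.
have off z' : cdom (T i) z' -> tvec z' != 0 -> K1 i z' = K2 i z'.
  move=> iz' z'0; apply/row_matrixP => k; rewrite !rowE.
  pose u := mkvec T (T i) z' (delta_mx 0 k).
  have uE : u i = delta_mx 0 k.
    by rewrite -(tcoord_atlas hT u iz'); exact: mkvecK.
  by rewrite -uE -E1 // -E2 // J12.
suff KE : K1 i z = K2 i z.
  apply: (tcoord_inj hT cTi iz); rewrite !(tcoord_atlas hT _ iz).
  by rewrite E1 // E2 // KE.
have [/eqP z0|z0] := boolP (tvec z == 0); last exact: off.
have sm1 := (smooth_inP hT _ cTi).1 s1 _ iz.
have sm2 := (smooth_inP hT _ cTi).1 s2 _ iz.
have cF := smooth_at_continuous (msmooth_chart hT cTi iz (msmoothB hT sm1 sm2)).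
have tE z' : cdom (T i) z' -> cmap (T i) z' =
    row_mx (cmap (A i) (base z')) (tcoord (A i) (tvec z')).
  by move=> iz'; exact: (tchart_of_atlas hA i).2.
have zE : cmap (T i) z = row_mx (cmap (A i) (base z)) 0.
  by rewrite tE // z0 (tcoord0 hA (Ac i) iz).
apply/eqP; rewrite -subr_eq0; apply/eqP.
rewrite -(local_repE (fun z => K1 i z - K2 i z) Ti iz) zE.
rewrite zE in cF; apply: (zero_fiber_limit e0 cF) => v v0.
pose z' := TVec (mkvec A (A i) (base z) v).
have vE : tcoord (A i) (tvec z') = v by exact: mkvecK.
have -> : row_mx (cmap (A i) (base z)) v = cmap (T i) z' by rewrite tE // vE.
rewrite (local_repE _ Ti) // off ?subrr //.
by apply: contra_neq v0 => z'0; rewrite -vE z'0 (tcoord0 hA (Ac i) iz).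
Qed.

Lemma smooth_partition_tbundle (c : nat -> chart R m M) (f : nat -> M -> R^o) :
  smooth_partition A c f ->
  smooth_partition T (fun k => tchart A (c k)) (fun k z => f k (base z)).
Proof.
move=> [cc sf sup lf].
(* A condition on the base point alone passes from the base to an induced chart and then to any
   compatible chart of the bundle. *)
have lift_near (P : M -> Prop) (d : chart R (m + m) (tbundle A)) z :
  compatible T d -> cdom d z ->
    (forall i, cdom (A i) (base z) -> chart_near P (A i) (base z)) ->
    chart_near (fun z' => P (base z')) d z.
  move=> cd dz nP; have [i iz] := cover (base z).
  apply: (chart_near_change hT (Tc i) cd iz dz).
  by apply: (tchart_near hA _ (Ac i) iz); exact: nP.
split.
- by move=> k; exact: tchart_compatible.
- by move=> k z; exact: (msmooth_base hA).
- move=> k d z cd dz ncz; apply: (lift_near (fun q => f k q = 0)) => // i iz.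
  exact: sup.
move=> z; have [N hN] := lf (base z); exists N => d cd dz.
apply: (lift_near (fun q => (forall k, (N <= k)%N -> f k q = 0) /\
  \sum_(0 <= k < N) f k q = 1)) => // i iz.
exact: hN.
Qed.

(** * The constructed lift is the complete lift of the para-complex structure *)

Section MainConstruction.
Variable J : endo_field A.
Hypothesis hJ : forall p, exists c, exists K,
  [/\ compatible A c, cdom c p & constant_in J c K].

Let Jc := lift_endo hA hJ.

(** In an adapted chart [block_diag K] acts on the components [Z] and ['D_v Z] separately, and the
    constant [K] commutes with the derivative along [v]. *)
Lemma lift_endo_lift_vfield (Z : vfield A) z : smooth_vfield Z ->
  Jc z (lift_vfield hA Z z) = lift_vfield hA (endo_app J Z) z.
Proof.
move=> /(smooth_vfieldP hA) sZ; have [c [K [cc cz JK]]] := hJ (base z).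
have cT := tchart_compatible hA cc.
have sJZ p : vsmooth (endo_app J Z) p.
  have [d [L [cd dp JL]]] := hJ p.
  by apply: (vsmooth_endo_app hA cd dp JL); exact: sZ.
apply: (tcoord_inj hT cT cz).
apply: etrans (constant_in_lift_endo hA hJ cc JK (lift_vfield hA Z z) cz) _.
apply: etrans (congr1 (mulmxr (block_diag K)) (tcoord_lift_vfield hA sZ cc cz)) _.
apply: etrans (row_mx_block_diag _ _ _) _.
apply: etrans _ (esym (tcoord_lift_vfield hA sJZ cc cz)).
have sc := vsmooth_chart hA cc cz (sZ (base z)).
congr row_mx; first exact/esym/JK.
apply: etrans (esym (tderiv_mulmxr hA _ _ sc)) _.
apply: (tderiv_near_eq hA _ cc cz).
  apply: chart_near_sub (chart_near_dom hA cc cc cz cz) => q cq _.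
  exact/esym/JK.
exact: (msmooth_mulmxr hA _ sc).
Qed.

Lemma complete_lift_lift_endo : complete_lift_endo J Jc.
Proof.
have sJ Z : smooth_vfield Z -> smooth_vfield (endo_app J Z).
  move=> /(smooth_vfieldP hA) sZ; apply/(smooth_vfieldP hA) => p.
  have [d [L [cd dp JL]]] := hJ p.
  by apply: (vsmooth_endo_app hA cd dp JL); exact: sZ.
have JZ (Z : vfield A) : smooth_vfield Z ->
    endo_app Jc (lift_vfield hA Z) = lift_vfield hA (endo_app J Z).
  move=> sZ; apply: functional_extensionality_dep => z.
  exact: lift_endo_lift_vfield.
split.
  split; first exact: smooth_lift_endo.
  move=> Z sZ; exists (lift_vfield hA Z); first exact: complete_lift_lift_vfield.
  by rewrite JZ //; apply: complete_lift_lift_vfield; exact: sJ.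
move=> J' [sJ' hJ']; apply: smooth_endo_field_eq => //; first
  exact: smooth_lift_endo.
move=> z w z0; have [Z [sZ <-]] := lift_vfield_surj w z0.
have [Zc [lZc _] [lJZc _]] := hJ' _ sZ.
have E : Zc z = lift_vfield hA Z z.
  exact: lifts_vfield_unique lZc (complete_lift_lift_vfield sZ).1 z.
apply: etrans _ (esym (lift_endo_lift_vfield z sZ)).
apply: etrans (congr1 (J' z) (esym E)) _.
exact: (lifts_vfield_unique lJZc (complete_lift_lift_vfield (sJ _ sZ)).1 z).
Qed.

End MainConstruction.

End Uniqueness.

Unset Implicit Arguments.

Theorem mainTheorem2 (R : realType) (m : nat) (M : topologicalType)
    (A : atlas R m M) (hM : smooth_manifold A)
    (J : endo_field A) (hJ : para_complex J) :
  exists Jc : endo_field (tatlas A),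
    complete_lift_endo J Jc /\
    exists D : vfield (tatlas A) -> vfield (tatlas A) -> vfield (tatlas A),
      [/\ affine_connection D,
          para_complex_connection Jc D &
          torsion_free D].
Proof.
have hA := smooth_manifold_atlas hM; have hT := smooth_tatlas hA.
have [_ intJ] := hJ.
have adapted p : exists c, [/\ is_chart c, compatible A c,
    (exists K, constant_in J c K) & cdom c p].
  have [c [K [lc cp JK]]] := intJ p; exists c; split=> //; first by case: lc.
    exact: local_coordinates_compatible.
  by exists K.
have hK p : exists c, exists K, [/\ compatible A c, cdom c p & constant_in J c K].
  by have [c [_ cc [K JK] cp]] := adapted p; exists c, K.
exists (lift_endo (smooth_manifold_atlas hM) hK); split.
  exact: complete_lift_lift_endo.
(* The empty chart, the filler of the partition, satisfies the predicate vacuously, with the matrix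
   0. *)
have [|c [f [hf cK]]] := @smooth_partition_exists _ _ _ A hM
  (fun c => exists K, constant_in J c K) _ adapted; first by exists 0 => q v [].
have hfT := smooth_partition_tbundle hM hf.
exists (glue hT hfT); split.
- exact: affine_connection_glue.
- apply: para_complex_glue => k; have [K JK] := cK k; exists (block_diag K).
  by apply: constant_in_lift_endo => //; have [] := hf.
- exact: torsion_free_glue.
Qed.
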